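(* Let $\{\boldsymbol{Z}_n\}$ be an irreducible, non-singular lower Hessenberg branching process with $M_{i,i+1}>0$ for all $i\ge 0$, with initial type $\varphi_0$, and let $\{Y_k\}_{k\ge\varphi_0}$ be its embedded process. Let $\mathcal E_g=\{\lim_{n\to\infty}\sum_{\ell\in\mathcal X}Z_{n,\ell}=0\}$ be the global extinction event and $\mathcal E_p=\{\lim_{n\to\infty}Z_{n,\ell}=0\ \forall\ell\in\mathcal X\}$ the partial extinction event. Then, up to null events, $$\mathcal E_g=\{\omega\in\Omega:\lim_{k\to\infty}Y_k(\omega)=0\}\quad\text{and}\quad\mathcal E_p=\{\omega\in\Omega:Y_k(\omega)<\infty\ \ \forall k\ge\varphi_0\}.$$
   Context: Lower Hessenberg branching process (LHBP): a multitype Galton-Watson process with type set $\mathcal X=\mathbb N_0=\{0,1,2,\dots\}$, started from a single individual of type $\varphi_0$, constructed on a probability space $(\Omega,\mathcal F,\mathbb P)$ carrying its family tree (Ulam-Harris construction). Each individual lives one generation; independently of all others, an individual of type $i$ has at death $r_\ell$ children of type $\ell$ ($\ell\in\mathcal X$) with probability $p_i(\boldsymbol r)$, where $\boldsymbol r\in R_i:=\{\boldsymbol r\in\mathbb N_0^{\mathcal X}: r_\ell=0\ \forall \ell>i+1\}$. $\boldsymbol Z_n=(Z_{n,\ell})_{\ell\in\mathcal X}$ counts the individuals of each type in generation $n$. Mean progeny matrix: $M_{i,j}$ is the expected number of type-$j$ children of a type-$i$ individual. Irreducible: in the directed graph on $\mathcal X$ with an edge $i\to j$ iff $M_{i,j}>0$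 there is a path between any two vertices. Non-singular: there is $i$ with $\sum_{\boldsymbol v:|\boldsymbol v|=1}p_i(\boldsymbol v)<1$, $|\boldsymbol v|=\sum_\ell v_\ell$. Process with sterile types: for $k\ge-1$, $\{\tilde{\boldsymbol Z}^{(k)}_n\}$ is obtained pathwise from $\{\boldsymbol Z_n\}$ by removing all descendants of individuals of type $>k$ (such individuals are kept but have no children). Embedded process: $Y_k=\sum_{n=0}^\infty\tilde Z^{(k-1)}_{n,k}\in\mathbb N_0\cup\{\infty\}$ for $k\ge\varphi_0$; that is, $Y_k$ counts the type-$k$ individuals of $\{\boldsymbol Z_n\}$ whose type is strictly larger than that of all their ancestors (so $Y_{\varphi_0}=1$). *)

(* Defs.v *)
From mathcomp Require Export all_boot all_order all_algebra.
From mathcomp Require Export finmap.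
From mathcomp Require Export all_classical all_reals all_analysis.

Set Implicit Arguments.
Unset Strict Implicit.
Unset Printing Implicit Defensive.

Import Order.TTheory GRing.Theory Num.Theory.
Import numFieldNormedType.Exports.

Local Open Scope classical_set_scope.
Local Open Scope ring_scope.
Local Open Scope ereal_scope.

(* [r l] is the number of children of type [l]. *)
Definition progeny := nat -> nat.

Definition hessenberg (i : nat) : set progeny :=
  [set r | forall l, (i.+1 < l)%N -> r l = 0%N].

(* |r| for [r] in [hessenberg i]; the coordinates beyond i + 1 vanish there. *)
Definition progeny_size (i : nat) (r : progeny) : nat :=
  (\sum_(l < i.+2) r l)%N.

(* Only the values of [p i] on [hessenberg i] are meaningful. *)
Definition is_progeny_law (R : realType) (p : nat -> progeny -> R) : Prop :=
  forall i, (forall r, hessenberg i r -> (0 <= p i r)%R) /\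
            \esum_(r in hessenberg i) (p i r)%:E = 1.

(* The mean number of children may be infinite. *)
Definition mean_progeny (R : realType) (p : nat -> progeny -> R)
    (i j : nat) : \bar R :=
  \esum_(r in hessenberg i) ((r j)%:R * p i r)%:E.

Definition irreducible (R : realType) (p : nat -> progeny -> R) : Prop :=
  forall i j, exists s : seq nat,
    path (fun a b => 0 < mean_progeny p a b) i s /\ last i s = j.

Definition nonsingular (R : realType) (p : nat -> progeny -> R) : Prop :=
  exists i, \esum_(v in [set v | hessenberg i v /\ progeny_size i v = 1%N])
              (p i v)%:E < 1.

(* An Ulam-Harris label lists pairs (type, rank), most recent generation first: [::] is the
   root, and (l, m) :: u is the m-th (from 0) child of type l of u. Thus the
   generation of u is [size u], and its ancestors are its proper suffixes. *)
Definition label := seq (nat * nat).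

Definition type_of (phi0 : nat) (u : label) : nat :=
  if u is x :: _ then x.1 else phi0.

Section Tree.
Variables (T : Type) (xi : label -> T -> progeny).

Fixpoint in_tree (w : T) (u : label) : Prop :=
  if u is x :: v then in_tree w v /\ (x.2 < xi v w x.1)%N else True.

Variable phi0 : nat.

(* [k] is an [int] to allow k = -1, for which even a root of type 0 is sterile. *)
Definition in_sterile_tree (k : int) (w : T) (u : label) : Prop :=
  in_tree w u /\
  forall v, suffix v u -> v != u -> ((type_of phi0 v)%:Z <= k)%R.

Variable R : realType.

Definition Z (n l : nat) (w : T) : \bar R :=
  counting [set u : label |
    [/\ in_tree w u, size u = n & type_of phi0 u = l]].

Definition Zsterile (k : int) (n l : nat) (w : T) : \bar R :=
  counting [set u : label |
    [/\ in_sterile_tree k w u, size u = n & type_of phi0 u = l]].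

(* For k < phi0 this is 0, the root being sterile. *)
Definition Y (k : nat) (w : T) : \bar R :=
  \sum_(0 <= n <oo) Zsterile (k%:Z - 1)%R n k w.

Definition global_extinction : set T :=
  [set w | (\sum_(0 <= l <oo) Z n l w) @[n --> \oo] --> 0].

Definition partial_extinction : set T :=
  [set w | forall l, Z n l w @[n --> \oo] --> 0].

End Tree.

Section Process.
Context (d : measure_display) (T : measurableType d) (R : realType).

(* As the progeny vectors take countably many values, no sigma-algebra on
   [progeny] is needed: independence is tested on arbitrary sets of values. *)
Definition mutually_independent (P : probability T R)
    (xi : label -> T -> progeny) : Prop :=
  forall (J : {fset label}) (A : label -> set progeny),
    P (\bigcap_(u in [set` J]) (xi u @^-1` A u)) =
    \prod_(u <- J) P (xi u @^-1` A u).

(* [xi u] is the progeny vector attached to every label [u], whether or not [u]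
   belongs to the tree. *)
Record lower_hessenberg_branching (phi0 : nat) (p : nat -> progeny -> R)
    (P : probability T R) (xi : label -> T -> progeny) : Prop := {
  lhb_law : is_progeny_law p;
  lhb_range : forall u w, hessenberg (type_of phi0 u) (xi u w);
  lhb_measurable : forall u r, measurable (xi u @^-1` [set r]);
  lhb_distribution : forall u r, hessenberg (type_of phi0 u) r ->
    P (xi u @^-1` [set r]) = (p (type_of phi0 u) r)%:E;
  lhb_independent : mutually_independent P xi }.

End Process.

(* Main.v *)
(* Let [rank] be the canonical numbering of labels; a parent has a smaller rank than its children.
   The labels of rank below [n] form a finite set, and the subtree of a label of rank [n] is
   independent of them. This gives the main tool: if infinitely many individuals of the tree
   satisfy a property of their label, and each starts, in its own subtree, a trial that fails in
   finite time with probability at most [q < 1], then almost surely some trial does not fail,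
   since the points whose first [m] successive trials fail have mass at most [q ^ m].

   With the trial "the line of first children of types [i + 1], [i + 2], ..., [k + 1] is there"
   an infinite tree truncated at type [k] produces infinitely many individuals that are counted
   by Y_(k+1); this gives the global part. For the partial part, trials along paths show that if
   some type recurs then so does phi0. If a truncation of the process started from phi0 survives
   with positive probability, the trial "the truncated subtree is infinite" shows that phi0 can
   only recur when some truncation of the whole tree is infinite, so that some Y_k is infinite.
   Otherwise let f be the probability generating function of the number of first returns to
   phi0. Then f(x) >= x on [0, 1), with strict inequality for x arbitrarily close to 1 by
   irreducibility and non-singularity; with s = x / f(x) < 1 the total number N of individuals of
   type phi0 satisfies E[s^N] >= x, whence N is almost surely finite. *)

Require Import Defs.
From mathcomp Require Import ring lra zify.

Set Implicit Arguments.
Unset Strict Implicit.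
Unset Printing Implicit Defensive.

Import Order.TTheory GRing.Theory Num.Theory.
Import numFieldNormedType.Exports.

Local Open Scope classical_set_scope.
Local Open Scope ring_scope.
Local Open Scope ereal_scope.

(** * Means under the progeny laws *)

Section Expectation.
Variables (R : realType) (p : nat -> progeny -> R).
Hypothesis law : is_progeny_law p.

(* Meaningful for bounded nonnegative [X] only: [fine] sends an infinite sum to 0. *)
Definition expect (i : nat) (X : progeny -> R) : R :=
  fine (\esum_(r in hessenberg i) (p i r * X r)%:E).

Definition bounded_progeny_fun (i : nat) (X : progeny -> R) : Prop :=
  exists C : R, forall r, hessenberg i r -> (0 <= X r <= C)%R.

Lemma progeny_law_ge0 i r : hessenberg i r -> (0 <= p i r)%R.
Proof. exact: (law i).1. Qed.

(** Finite subsums suffice for this direction; the reverse one is this bound with the inverse of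
    [c], as in [expectZ]. *)
Lemma le_esumZl (I : set progeny) (c : R) (a : progeny -> R) : (0 <= c)%R ->
  (forall r, I r -> (0 <= a r)%R) ->
  \esum_(r in I) (c * a r)%:E <= c%:E * \esum_(r in I) (a r)%:E.
Proof.
move=> c0 a0; apply: ge_ereal_sup => _ [X [finX XI] <-].
have -> : \sum_(r \in X) (c * a r)%:E = c%:E * \sum_(r \in X) (a r)%:E.
  by rewrite !fsbig_finite// !sumEFin -EFinM mulr_sumr.
by apply: lee_wpmul2l; [rewrite lee_fin|apply: esum_ge; exists X].
Qed.

Lemma expect_esum i X : bounded_progeny_fun i X ->
  \esum_(r in hessenberg i) (p i r * X r)%:E = (expect i X)%:E.
Proof.
move=> [C bX]; rewrite fineK// ge0_fin_numE; last first.
  by apply: esum_ge0 => r hr; rewrite lee_fin mulr_ge0 ?progeny_law_ge0//;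
     case/andP: (bX _ hr).
have C0 : (0 <= C)%R.
  have h0 : hessenberg i (fun=> 0%N) by [].
  by case/andP: (bX _ h0); exact: le_trans.
apply: (@le_lt_trans _ _ (\esum_(r in hessenberg i) (C * p i r)%:E)).
  apply: le_esum => r hr; rewrite lee_fin [leRHS]mulrC ler_wpM2l//.
    exact: progeny_law_ge0.
  by case/andP: (bX _ hr).
apply: le_lt_trans (le_esumZl C0 (@progeny_law_ge0 i)) _.
by rewrite (law i).2 mule1 ltry.
Qed.

Lemma bounded_cst i (c : R) : (0 <= c)%R -> bounded_progeny_fun i (fun=> c).
Proof. by move=> c0; exists c => r _; rewrite c0 lexx. Qed.

Lemma bounded_unit i X : (forall r, hessenberg i r -> (0 <= X r <= 1)%R) ->
  bounded_progeny_fun i X.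
Proof. by move=> X1; exists 1%R. Qed.

Lemma boundedD i X Y : bounded_progeny_fun i X -> bounded_progeny_fun i Y ->
  bounded_progeny_fun i (fun r => X r + Y r)%R.
Proof.
move=> [C bX] [D bY]; exists (C + D)%R => r hr.
have /andP[? ?] := bX _ hr; have /andP[? ?] := bY _ hr.
by rewrite addr_ge0//= lerD.
Qed.

Lemma boundedM i X Y : bounded_progeny_fun i X -> bounded_progeny_fun i Y ->
  bounded_progeny_fun i (fun r => X r * Y r)%R.
Proof.
move=> [C bX] [D bY]; exists (C * D)%R => r hr.
have /andP[? ?] := bX _ hr; have /andP[? ?] := bY _ hr.
by rewrite mulr_ge0//= ler_pM.
Qed.

Lemma boundedZ i (c : R) X : (0 <= c)%R -> bounded_progeny_fun i X ->
  bounded_progeny_fun i (fun r => c * X r)%R.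
Proof. by move=> c0 bX; apply: boundedM => //; exact: bounded_cst. Qed.

Lemma expect_cst i (c : R) : (0 <= c)%R -> expect i (fun=> c) = c.
Proof.
move=> c0; apply/EFin_inj; rewrite -expect_esum; last exact: bounded_cst.
have /orP[/eqP<-|cgt0] : (0 == c)%R || (0 < c)%R by rewrite -le_eqVlt.
  by rewrite esum1// => r _; rewrite mulr0.
apply/eqP; rewrite eq_le; apply/andP; split.
  under eq_esum do rewrite mulrC.
  apply: le_trans (le_esumZl c0 (@progeny_law_ge0 i)) _.
  by rewrite (law i).2 mule1.
have : 1 <= c^-1%:E * \esum_(r in hessenberg i) (p i r * c)%:E.
  rewrite -(law i).2 (le_trans _ (le_esumZl _ _)) ?invr_ge0//.
    by apply: le_esum => r _; rewrite lee_fin mulrCA mulVf ?gt_eqF// mulr1.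
  by move=> r hr; rewrite mulr_ge0// progeny_law_ge0.
by rewrite lee_pdivlMl// mule1.
Qed.

Lemma expectD i X Y : bounded_progeny_fun i X -> bounded_progeny_fun i Y ->
  expect i (fun r => X r + Y r)%R = (expect i X + expect i Y)%R.
Proof.
move=> bX bY; apply/EFin_inj; rewrite EFinD -!expect_esum//; last exact: boundedD.
case: bX bY => [C bX] [D bY].
rewrite -esumD; last 2 first.
- by move=> r hr; rewrite lee_fin mulr_ge0 ?progeny_law_ge0//; case/andP: (bX _ hr).
- by move=> r hr; rewrite lee_fin mulr_ge0 ?progeny_law_ge0//; case/andP: (bY _ hr).
by apply: eq_esum => r _; rewrite mulrDr EFinD.
Qed.

Lemma le_expect i X Y : bounded_progeny_fun i X -> bounded_progeny_fun i Y ->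
  (forall r, hessenberg i r -> (X r <= Y r)%R) -> (expect i X <= expect i Y)%R.
Proof.
move=> bX bY XY; rewrite -lee_fin -!expect_esum//; apply: le_esum => r hr.
by rewrite lee_fin ler_wpM2l ?XY// progeny_law_ge0.
Qed.

Lemma eq_expect i X Y : (forall r, hessenberg i r -> X r = Y r) ->
  expect i X = expect i Y.
Proof. by move=> XY; congr fine; apply: eq_esum => r hr; rewrite XY. Qed.

Lemma expect_ge0 i X : bounded_progeny_fun i X -> (0 <= expect i X)%R.
Proof.
move=> bX; rewrite -(@expect_cst i 0%R)//; apply: le_expect => //.
  exact: bounded_cst.
by case: bX => C bX r /bX/andP[].
Qed.

Lemma expectZ i (c : R) X : (0 <= c)%R -> bounded_progeny_fun i X ->
  expect i (fun r => c * X r)%R = (c * expect i X)%R.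
Proof.
move=> c0 bX; have X0 r : hessenberg i r -> (0 <= p i r * X r)%R.
  by move=> hr; rewrite mulr_ge0 ?progeny_law_ge0//; case: bX => C /(_ _ hr)/andP[].
have lec (a : R) Y : (0 <= a)%R -> bounded_progeny_fun i Y ->
    (expect i (fun r => a * Y r) <= a * expect i Y)%R.
  move=> a0 bY; rewrite -lee_fin EFinM -!expect_esum//; last exact: boundedZ.
  under eq_esum do rewrite mulrCA.
  apply: le_esumZl => // r hr.
  by rewrite mulr_ge0 ?progeny_law_ge0//; case: bY => C /(_ _ hr)/andP[].
apply/eqP; rewrite eq_le lec//=.
have /orP[/eqP<-|cgt0] : (0 == c)%R || (0 < c)%R by rewrite -le_eqVlt.
  by rewrite mul0r expect_ge0//; exact: boundedZ.
rewrite -ler_pdivlMl// (le_trans _ (lec _ _ _ _)) ?invr_ge0//; last exact: boundedZ.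
apply: le_expect => //; first by apply: boundedZ; rewrite ?invr_ge0//; exact: boundedZ.
by move=> r _; rewrite mulrA mulVf ?mul1r// gt_eqF.
Qed.

Lemma expect_le1 i X : (forall r, hessenberg i r -> (0 <= X r <= 1)%R) ->
  (0 <= expect i X <= 1)%R.
Proof.
move=> X1; rewrite expect_ge0//=; last exact: bounded_unit.
rewrite -[leRHS](@expect_cst i)//; apply: le_expect.
- exact: bounded_unit.
- exact: bounded_cst.
by move=> r /X1/andP[].
Qed.

Lemma expect_eq0 i X r : bounded_progeny_fun i X -> expect i X = 0%R ->
  hessenberg i r -> (0 < p i r)%R -> X r = 0%R.
Proof.
move=> bX X0 hr pr; have /andP[Xr0 _] : (0 <= X r <= X r)%R.
  by rewrite lexx; case: bX => C /(_ _ hr)/andP[->].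
apply/eqP; rewrite eq_le Xr0 andbT -(pmulr_rle0 _ pr) -lee_fin -X0 -expect_esum//.
apply: esum_ge; exists [set r]; last by rewrite fsbig_set1.
by split => // _ ->.
Qed.

(** A mean equal to 1 would give [1 - X] the mean 0, so [X] would be 1 wherever [p i] is
    positive. *)
Lemma expect_lt1 i X r : (forall r, hessenberg i r -> (0 <= X r <= 1)%R) ->
  hessenberg i r -> (0 < p i r)%R -> (X r < 1)%R -> (expect i X < 1)%R.
Proof.
move=> X1 hr pr Xr; rewrite lt_neqAle; have /andP[_ ->] := expect_le1 X1.
rewrite andbT; apply/eqP => E1.
have bY : bounded_progeny_fun i (fun r => 1 - X r)%R.
  by apply: bounded_unit => s /X1/andP[? ?]; rewrite subr_ge0 gerBl; apply/andP.
have : (expect i X + expect i (fun r => 1 - X r) = 1)%R.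
  rewrite -expectD//; last exact: bounded_unit.
  by rewrite -[RHS](@expect_cst i)//; apply: eq_expect => s _; rewrite subrKC.
rewrite E1 => /eqP; rewrite -subr_eq0 addrAC subrr add0r => /eqP /(expect_eq0 bY).
by move=> /(_ _ hr pr)/eqP; rewrite subr_eq0 gt_eqF.
Qed.

(** Keeping the variance as an exact term gives not only Jensen's inequality for squares but also
    its equality case. *)
Lemma expect_sqr i X : (forall r, hessenberg i r -> (0 <= X r <= 1)%R) ->
  (expect i (fun r => X r ^+ 2) =
   expect i X ^+ 2 + expect i (fun r => (X r - expect i X) ^+ 2))%R.
Proof.
move=> X1; set m := expect i X; have /andP[m0 m1] : (0 <= m <= 1)%R := expect_le1 X1.
have bX := bounded_unit X1.
have bX2 : bounded_progeny_fun i (fun r => X r ^+ 2)%R by exact: boundedM.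
have bV : bounded_progeny_fun i (fun r => (X r - m) ^+ 2)%R.
  apply: bounded_unit => r /X1/andP[X0 X1r]; rewrite sqr_ge0/= -[leRHS](expr1n _ 2).
  by rewrite -real_normK ?num_real// lerXn2r ?nnegrE//; rewrite ler_norml; apply/andP; split; lra.
have : expect i (fun r => X r ^+ 2 + m ^+ 2)%R =
       expect i (fun r => (2 * m) * X r + (X r - m) ^+ 2)%R.
  by apply: eq_expect => r _; ring.
have bm : bounded_progeny_fun i (fun=> m ^+ 2)%R by apply: bounded_cst; exact: sqr_ge0.
have m20 : (0 <= 2 * m)%R by rewrite mulr_ge0.
have bZ := boundedZ m20 bX.
rewrite !expectD// expect_cst ?sqr_ge0// expectZ//.
rewrite -/m => e; apply: (addIr (m ^+ 2)%R); rewrite e; ring.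
Qed.

(* Outside a finite set of progenies of mass at least [1 - e / 2] the bound [X n <= 1] is enough;
   on that set the convergence is uniform. *)
Lemma expect_continuous i (X : nat -> progeny -> R) (Y : progeny -> R) (e : R) :
  (forall n r, hessenberg i r -> (0 <= X n r <= 1)%R) ->
  (forall r, hessenberg i r -> (0 <= Y r <= 1)%R) ->
  (forall m n r, hessenberg i r -> (m <= n)%N -> (X n r <= X m r)%R) ->
  (forall r c, hessenberg i r -> (0 < c)%R -> exists n, (X n r <= Y r + c)%R) ->
  (0 < e)%R -> exists n, (expect i (X n) <= expect i Y + e)%R.
Proof.
move=> X1 Y1 Xmono XY e0.
have e20 : (0 < e / 2)%R by rewrite divr_gt0.
have [F [finF FI] Fe] : exists2 F, fsets (hessenberg i) F &
    ((1 - e / 2)%R%:E < \sum_(r \in F) (p i r)%:E)%E.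
  have : ((1 - e / 2)%R%:E < \esum_(r in hessenberg i) (p i r)%:E)%E.
    by rewrite (law i).2 lte_fin ltrBlDr ltrDl.
  by move=> /ereal_sup_gt[_ [F FI <-]] ?; exists F.
have [n nF] : exists n, forall r, F r -> (X n r <= Y r + e / 2)%R.
  have /finite_seqP[s Fs] := finF.
  have sI r : r \in s -> hessenberg i r by move=> rs; apply: FI; rewrite Fs.
  suff [n nP] : exists n, forall r, r \in s -> (X n r <= Y r + e / 2)%R.
    by exists n => r; rewrite Fs => /nP.
  elim: s sI {Fs} => [|r s IH] sI; first by exists 0%N.
  have [|n nP] := IH; first by move=> t ts; apply: sI; rewrite inE ts orbT.
  have hr : hessenberg i r by apply: sI; rewrite mem_head.
  have [m mP] := XY r (e / 2)%R hr e20.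
  exists (maxn m n) => t; rewrite inE => /predU1P[->|ts].
    by apply: le_trans mP; exact: Xmono hr (leq_maxl _ _).
  apply: le_trans (nP _ ts); apply: Xmono (leq_maxr _ _).
  by apply: sI; rewrite inE ts orbT.
(* [J] is the indicator of the complement of [F], of mean at most [e / 2]; off [F] it absorbs
   [X n <= 1]. *)
exists n; pose J r : R := if r \in F then 0%R else 1%R.
have J1 r : hessenberg i r -> (0 <= J r <= 1)%R.
  by move=> _; rewrite /J; case: ifP; rewrite ?lexx ?ler01.
have J1' r : hessenberg i r -> (0 <= 1 - J r <= 1)%R.
  by move=> _; rewrite /J; case: ifP; rewrite ?subr0 ?subrr ?lexx ?ler01.
have EJ : (expect i J <= e / 2)%R.
  have : (expect i J + expect i (fun r => 1 - J r) = 1)%R.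
    rewrite -expectD; try exact: bounded_unit.
    by rewrite -[RHS](@expect_cst i)//; apply: eq_expect => s _; rewrite subrKC.
  have : (1 - e / 2 <= expect i (fun r => 1 - J r))%R.
    rewrite -lee_fin -expect_esum; last exact: bounded_unit.
    apply: le_trans (ltW Fe) _; apply: esum_ge; exists F => //.
    apply: lee_fsum => // r Fr; rewrite lee_fin /J mem_set// subr0 mulr1.
    exact: lexx.
  by lra.
have : (expect i (X n) <= expect i (fun r => (Y r + e / 2) + J r))%R.
  apply: le_expect.
  - exact: bounded_unit (X1 n).
  - apply: boundedD; last exact: bounded_unit.
    by apply: boundedD; [exact: bounded_unit|apply: bounded_cst; exact: ltW].
  move=> r hr; rewrite /J; case: ifPn => [/set_mem/nF|_]; first by rewrite addr0.
  have /andP[_ X1r] := X1 n r hr; have /andP[Y0 _] := Y1 r hr.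
  by move: e20 X1r Y0; lra.
rewrite !expectD ?expect_cst ?(ltW e20)//; first by move: EJ; lra.
- exact: bounded_unit.
- by apply: bounded_cst; exact: ltW.
- by apply: boundedD; [exact: bounded_unit|apply: bounded_cst; exact: ltW].
- exact: bounded_unit.
Qed.

End Expectation.

(** * Generating functions *)

Section GeneratingFunction.
Variables (R : realType) (p : nat -> progeny -> R).
Hypothesis law : is_progeny_law p.

(** The product stops at type i + 1, beyond which the vectors of [hessenberg i] vanish. *)
Definition progeny_prod (h : nat -> R) (i : nat) (r : progeny) : R :=
  (\prod_(l < i.+2) h l ^+ r l)%R.

Definition gen_fun (h : nat -> R) (i : nat) : R := expect p i (progeny_prod h i).

Definition unit_valued (h : nat -> R) := forall j, (0 <= h j <= 1)%R.

Lemma progeny_prod_unit h i r : unit_valued h -> (0 <= progeny_prod h i r <= 1)%R.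
Proof.
move=> h1; rewrite prodr_ge0 => [|l _] /=; last first.
  by rewrite exprn_ge0//; case/andP: (h1 l).
by apply: Num.Theory.prodr_ile1 => l _; have /andP[? ?] := h1 l; rewrite exprn_ge0//= exprn_ile1.
Qed.

Lemma le_progeny_prod g h i r : unit_valued g -> (forall j, g j <= h j)%R ->
  (progeny_prod g i r <= progeny_prod h i r)%R.
Proof.
move=> g1 gh; apply: ler_prod => l _; have /andP[g0 _] := g1 l.
by rewrite exprn_ge0//= lerXn2r// nnegrE// (le_trans g0).
Qed.

Lemma progeny_prod_sqr h i r :
  progeny_prod (fun j => h j ^+ 2)%R i r = (progeny_prod h i r ^+ 2)%R.
Proof. by rewrite -prodrXl; apply: eq_bigr => l _; rewrite exprAC. Qed.

Lemma progeny_prod_bounded h i : unit_valued h ->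
  bounded_progeny_fun i (progeny_prod h i).
Proof. by move=> h1; apply: bounded_unit => r _; exact: progeny_prod_unit. Qed.

Lemma unit_valued_sqr h : unit_valued h -> unit_valued (fun j => h j ^+ 2)%R.
Proof.
by move=> h1 j; have /andP[? ?] := h1 j; rewrite sqr_ge0 exprn_ile1.
Qed.

Lemma gen_fun_unit h : unit_valued h -> unit_valued (gen_fun h).
Proof.
by move=> h1 j; apply: expect_le1 => // r _; exact: progeny_prod_unit.
Qed.

Lemma le_gen_fun g h i : unit_valued g -> unit_valued h ->
  (forall j, g j <= h j)%R -> (gen_fun g i <= gen_fun h i)%R.
Proof.
move=> g1 h1 gh; apply: le_expect => //; try exact: progeny_prod_bounded.
by move=> r _; exact: le_progeny_prod.
Qed.

(** Squaring commutes with monomials, so passing from [h] to its square adds exactly a variance. *)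
Lemma gen_fun_sqr h i : unit_valued h ->
  gen_fun (fun j => h j ^+ 2)%R i = (gen_fun h i ^+ 2 +
    expect p i (fun r => (progeny_prod h i r - gen_fun h i) ^+ 2))%R.
Proof.
move=> h1; rewrite -expect_sqr//; last by move=> r _; exact: progeny_prod_unit.
by apply: eq_expect => r _; exact: progeny_prod_sqr.
Qed.

Lemma variance_bounded h i : unit_valued h ->
  bounded_progeny_fun i (fun r => (progeny_prod h i r - gen_fun h i) ^+ 2)%R.
Proof.
move=> h1; apply: bounded_unit => r _; rewrite sqr_ge0/=.
have /andP[? ?] := progeny_prod_unit i r h1; have /andP[? ?] := gen_fun_unit h1 i.
rewrite -[leRHS](expr1n _ 2) -real_normK ?num_real// lerXn2r ?nnegrE//.
by rewrite ler_norml; apply/andP; split; lra.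
Qed.

Lemma gen_fun_sqr_ge h i : unit_valued h ->
  (gen_fun h i ^+ 2 <= gen_fun (fun j => h j ^+ 2)%R i)%R.
Proof.
move=> h1; rewrite gen_fun_sqr// lerDl; apply: expect_ge0 => //.
exact: variance_bounded.
Qed.

Lemma progeny_prod_le h i r j : unit_valued h -> hessenberg i r -> (0 < r j)%N ->
  (progeny_prod h i r <= h j)%R.
Proof.
move=> h1 hr rj; have ji : (j < i.+2)%N.
  by rewrite ltnNge; apply: contraL rj => /hr ->.
rewrite /progeny_prod (bigD1 (Ordinal ji))//=; have /andP[? ?] := h1 j.
rewrite -[leRHS]mulr1 ler_pM ?exprn_ge0//.
- by apply: prodr_ge0 => l _; rewrite exprn_ge0//; case/andP: (h1 l).
- by rewrite -[leRHS]expr1 ler_wiXn2l.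
by apply: Num.Theory.prodr_ile1 => l _; have /andP[? ?] := h1 l; rewrite exprn_ge0//= exprn_ile1.
Qed.

(** Positivity of the whole product makes the product of the other factors positive, so a strict
    inequality at [j] would make the products differ. *)
Lemma progeny_prod_inj g h i r j : unit_valued g -> unit_valued h ->
  (forall j, g j <= h j)%R -> hessenberg i r -> (0 < r j)%N ->
  (0 < progeny_prod g i r)%R -> progeny_prod g i r = progeny_prod h i r -> g j = h j.
Proof.
move=> g1 h1 gh hr rj; have ji : (j < i.+2)%N.
  by rewrite ltnNge; apply: contraL rj => /hr ->.
have split_j f : progeny_prod f i r =
    (f j ^+ r j * \prod_(l < i.+2 | l != Ordinal ji) f l ^+ r l)%R.
  by rewrite /progeny_prod (bigD1 (Ordinal ji)).
rewrite !split_j.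
set G := (\prod_(l < _ | _) g l ^+ r l)%R; set H := (\prod_(l < _ | _) h l ^+ r l)%R.
have /andP[g0 _] := g1 j; have /andP[h0 _] := h1 j.
have G0 : (0 <= G)%R.
  by apply: prodr_ge0 => l _; rewrite exprn_ge0//; case/andP: (g1 l).
have GH : (G <= H)%R.
  apply: ler_prod => l _; have /andP[? _] := g1 l; have /andP[? _] := h1 l.
  by rewrite exprn_ge0//= lerXn2r.
move=> /[dup] gG0 + e; have Gp : (0 < G)%R.
  by rewrite lt_neqAle G0 andbT eq_sym; apply: contraTneq gG0 => ->; rewrite mulr0 ltxx.
move=> _; apply/eqP; rewrite eq_le gh /= leNgt; apply/negP => gjhj.
have : (g j ^+ r j * G < h j ^+ r j * H)%R.
  apply: (@lt_le_trans _ _ (h j ^+ r j * G)%R).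
    by rewrite ltr_pM2r// ltrXn2r// -?lt0n.
  by rewrite ler_wpM2l// exprn_ge0.
by rewrite e ltxx.
Qed.

Lemma mean_gt0_progeny i j : 0 < mean_progeny p i j ->
  exists r, [/\ hessenberg i r, (0 < p i r)%R & (0 < r j)%N].
Proof.
apply: contraPP => /forallNP nr; rewrite /mean_progeny esum1 ?ltxx// => r hr.
have [rj|rj] := posnP (r j); first by rewrite rj mul0r.
have := progeny_law_ge0 law hr; rewrite le_eqVlt => /predU1P[<-|pr].
  by rewrite mulr0.
by case: (nr r).
Qed.

(* Equality in [gen_fun h i ^+ 2 <= gen_fun (h ^+ 2) i <= gen_fun g i] forces
   [progeny_prod h i] to be constant on the support of [p i]. *)
Lemma gen_fun_sqr_eq g h i r : unit_valued g -> unit_valued h ->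
  (forall j, h j ^+ 2 <= g j)%R -> gen_fun g i = (gen_fun h i ^+ 2)%R ->
  hessenberg i r -> (0 < p i r)%R ->
  progeny_prod h i r = gen_fun h i /\
  progeny_prod (fun j => h j ^+ 2)%R i r = progeny_prod g i r.
Proof.
move=> g1 h1 hg e hr pr; have h21 := unit_valued_sqr h1.
have bg := progeny_prod_bounded i g1; have bh := progeny_prod_bounded i h21.
have le1 := le_gen_fun i h21 g1 hg.
have V0 := expect_ge0 law (variance_bounded i h1).
split.
  have : expect p i (fun r => (progeny_prod h i r - gen_fun h i) ^+ 2)%R = 0%R.
    by apply/eqP; rewrite eq_le V0 andbT; move: le1; rewrite gen_fun_sqr// e; lra.
  move=> /(expect_eq0 law (variance_bounded i h1))/(_ hr pr)/eqP.
  by rewrite sqrf_eq0 subr_eq0 => /eqP.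
pose D s := (progeny_prod g i s - progeny_prod (fun j => h j ^+ 2) i s)%R.
have bD : bounded_progeny_fun i D.
  apply: bounded_unit => s _; rewrite subr_ge0 le_progeny_prod//=.
  have /andP[? ?] := progeny_prod_unit i s g1; have /andP[? ?] := progeny_prod_unit i s h21.
  by rewrite /D; lra.
have : (gen_fun (fun j => h j ^+ 2) i + expect p i D = gen_fun g i)%R.
  by rewrite -expectD//; apply: eq_expect => s _; rewrite /D subrKC.
have := gen_fun_sqr_ge i h1; rewrite -e => le2.
have -> : gen_fun (fun j => h j ^+ 2)%R i = gen_fun g i by apply/eqP; rewrite eq_le le1.
move=> eD; have {eD} : expect p i D = 0%R by lra.
by move=> /(expect_eq0 law bD)/(_ hr pr)/eqP; rewrite subr_eq0 => /eqP.
Qed.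

Hypothesis irr : irreducible p.
Hypothesis nsing : nonsingular p.

(** Equality in Jensen's inequality at [phi0] spreads along the edges of the type graph: on the
    support of [p i] the monomial in [h] is constant, which forces equality at each possible child
    type. *)
Lemma no_squared_fixpoint (phi0 : nat) (g h : nat -> R) (y : R) :
  unit_valued g -> unit_valued h -> (0 < y < 1)%R -> h phi0 = y ->
  g phi0 = (y ^+ 2)%R -> (forall j, h j ^+ 2 <= g j)%R ->
  (forall j, gen_fun h j = h j) -> (forall j, gen_fun g j = g j) -> False.
Proof.
move=> g1 h1 /andP[y0 y1] hy gy hg fh fg.
pose Pi j := g j = (h j ^+ 2)%R /\ (y <= h j)%R.
have gen_eq i : Pi i -> gen_fun g i = (gen_fun h i ^+ 2)%R.
  by move=> [e _]; rewrite fg fh e.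
have edge i j : Pi i -> 0 < mean_progeny p i j -> Pi j /\ (h i <= h j)%R.
  move=> Pii /mean_gt0_progeny[r [hr pr rj]]; have [gi yi] := Pii.
  have [ph pg] := gen_fun_sqr_eq g1 h1 hg (gen_eq _ Pii) hr pr.
  rewrite fh in ph.
  have hij : (h i <= h j)%R by rewrite -ph; exact: progeny_prod_le.
  split => //; split; last exact: le_trans hij.
  apply/esym; apply: progeny_prod_inj (unit_valued_sqr h1) g1 hg hr rj _ pg.
  by rewrite progeny_prod_sqr ph exprn_gt0// (lt_le_trans y0).
have walk i s : Pi i -> path (fun a b => 0 < mean_progeny p a b) i s ->
    Pi (last i s) /\ (h i <= h (last i s))%R.
  elim: s i => [|a s IH] i Pii //= /andP[ia /IH{}IH].
  have [Pa ha] := edge _ _ Pii ia; have [? ?] := IH Pa.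
  by split => //; exact: le_trans ha _.
have Pphi : Pi phi0 by split; rewrite ?gy hy.
(* [h] cannot decrease along a path, and a path from [phi0] to [i] can be closed up, so [h] is
   constant. *)
have hE i : h i = y.
  have [s [/(walk _ _ Pphi)[+ _] <-]] := irr phi0 i.
  set j := last _ _ => Pj.
  have [t [/(walk _ _ Pj)[_ +] e]] := irr j phi0.
  by rewrite e hy => ?; apply/eqP; rewrite eq_le; case: Pj => _ ->; rewrite andbT.
have [i ni] := nsing.
have PiT : Pi i by have [s [/(walk _ _ Pphi)[+ _] <-]] := irr phi0 i.
(* For constant [h] the monomial is [y ^ |r|]; as 0 < y < 1, it equals [y] only if |r| = 1, for
   every type, against non-singularity. *)
have size1 r : hessenberg i r -> (0 < p i r)%R -> progeny_size i r = 1%N.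
  move=> hr pr.
  have [+ _] := gen_fun_sqr_eq g1 h1 hg (gen_eq _ PiT) hr pr.
  rewrite fh hE /progeny_prod; under eq_bigr do rewrite hE.
  rewrite prodrXr -/(progeny_size i r) => e; apply/eqP/negPn/negP => n1.
  suff : (y ^+ progeny_size i r != y)%R by rewrite e eqxx.
  have [->|n0] := posnP (progeny_size i r); first by rewrite expr0 gt_eqF.
  rewrite lt_eqF// -[ltRHS]expr1 ltr_iXn2l//; lia.
have := law i; case=> _; rewrite (esumID [set v | progeny_size i v = 1%N]); last first.
  by move=> r hr; rewrite lee_fin; exact: progeny_law_ge0 hr.
rewrite [X in _ + X]esum1 => [|r [hr ns]]; last first.
  by have := progeny_law_ge0 law hr; rewrite le_eqVlt => /predU1P[<-//|/(size1 _ hr)].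
by rewrite adde0 => e; move: ni; rewrite -e ltxx.
Qed.

(** * First returns to the initial type *)

Variable phi0 : nat.

(* The iterate [n] is 1 at all types from [n] on except [phi0]: a fixed point is approached by
   functions that only involve finitely many types. *)
Fixpoint first_return (x : R) (n : nat) : nat -> R :=
  if n is m.+1 then
    fun j => if j == phi0 then x
             else if (j <= m)%N then gen_fun (first_return x m) j else 1%R
  else fun j => if j == phi0 then x else 1%R.

Lemma first_return_unit x n : (0 <= x <= 1)%R -> unit_valued (first_return x n).
Proof.
move=> x1; elim: n => [|n IH] j /=; case: ifP => // _; first by rewrite ler01 lexx.
by case: ifP => _; [exact: gen_fun_unit|rewrite ler01 lexx].
Qed.

Lemma first_return_phi0 x n : first_return x n phi0 = x.
Proof. by case: n => [|n] /=; rewrite eqxx. Qed.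

Lemma first_returnS x n j : (0 <= x <= 1)%R ->
  (first_return x n.+1 j <= first_return x n j)%R.
Proof.
move=> x1; elim: n j => [|n IH] j.
  rewrite /=; case: ifP => // _; case: ifP => // _.
  by case/andP: (gen_fun_unit (first_return_unit 0 x1) j).
rewrite [in leLHS]/= [in leRHS]/=; case: ifP => // _.
case: ifP => [jn|]; last by move=> jn; rewrite ifF//; apply: contraFF jn => /leqW.
case: ifP => [_|_]; last by case/andP: (gen_fun_unit (first_return_unit n.+1 x1) j).
exact: le_gen_fun (first_return_unit n.+1 x1) (first_return_unit n x1) IH.
Qed.

Lemma first_return_le x m n j : (0 <= x <= 1)%R -> (m <= n)%N ->
  (first_return x n j <= first_return x m j)%R.
Proof.
move=> x1 /subnK <-; elim: (n - m)%N => // k IH.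
by apply: le_trans IH; rewrite addSn; exact: first_returnS.
Qed.

(** Where an iterate is not set to 1 it is [gen_fun] of the preceding iterate, which is larger. *)
Lemma gen_fun_first_return x n j : (0 <= x <= 1)%R -> j != phi0 ->
  (gen_fun (first_return x n) j <= first_return x n j)%R.
Proof.
move=> x1 jphi; have w1 m := first_return_unit m x1.
case: n => [|n] /=.
  by rewrite (negbTE jphi); case/andP: (gen_fun_unit (w1 0%N) j).
rewrite (negbTE jphi); case: ifP => _.
  by apply: le_gen_fun => //; [exact: w1 n.+1|move=> l; exact: first_returnS].
by case/andP: (gen_fun_unit (w1 n.+1) j).
Qed.

(* [ret_gf x j] is the mean of [x ^ N], with [N] the number of descendants of type [phi0] of an
   individual of type [j] that are the first of that type on their line. *)
Definition ret_gf (x : R) (j : nat) : R := inf (range (first_return x ^~ j)).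

Lemma ret_gf_le x n j : (0 <= x <= 1)%R -> (ret_gf x j <= first_return x n j)%R.
Proof.
move=> x1; apply: ge_inf; last by exists n.
by exists 0%R => _ [m _ <-]; case/andP: (first_return_unit m x1 j).
Qed.

Lemma ret_gf_ge x j c : (forall n, c <= first_return x n j)%R -> (c <= ret_gf x j)%R.
Proof.
by move=> wc; apply: lb_le_inf; [exists (first_return x 0 j), 0%N|move=> _ [m _ <-]].
Qed.

Lemma ret_gf_unit x : (0 <= x <= 1)%R -> unit_valued (ret_gf x).
Proof.
move=> x1 j; apply/andP; split.
  by apply: ret_gf_ge => n; case/andP: (first_return_unit n x1 j).
by apply: le_trans (ret_gf_le 0 j x1) _; case/andP: (first_return_unit 0 x1 j).
Qed.

Lemma ret_gf_phi0 x : (0 <= x <= 1)%R -> ret_gf x phi0 = x.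
Proof.
move=> x1; apply/eqP; rewrite eq_le -{2}(first_return_phi0 x 0) ret_gf_le//=.
by apply: ret_gf_ge => n; rewrite first_return_phi0.
Qed.

Lemma ret_gf_approx x (e : R) (j : nat) : (0 <= x <= 1)%R -> (0 < e)%R ->
  exists n, (first_return x n j <= ret_gf x j + e)%R.
Proof.
move=> x1 e0; have hi : has_inf (range (first_return x ^~ j)).
  split; first by exists (first_return x 0 j), 0%N.
  by exists 0%R => _ [m _ <-]; case/andP: (first_return_unit m x1 j).
by have [_ [n _ <-] /ltW] := inf_adherent e0 hi; exists n.
Qed.

(** A monomial has finitely many factors in [0, 1], whose errors add up; powers come first, then the
    product over the types. *)
Lemma progeny_prod_first_return x i r (c : R) : (0 <= x <= 1)%R -> (0 < c)%R ->
  exists n, (progeny_prod (first_return x n) i r <= progeny_prod (ret_gf x) i r + c)%R.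
Proof.
move=> x1 c0; have w1 m := first_return_unit m x1; have u1 := ret_gf_unit x1.
have approx_pow j k e : (0 < e)%R ->
    exists n, (first_return x n j ^+ k <= ret_gf x j ^+ k + e)%R.
  elim: k e => [|k IH] e e0; first by exists 0%N; rewrite !expr0 lerDl ltW.
  have e2 : (0 < e / 2)%R by rewrite divr_gt0.
  have [n nP] := IH _ e2; have [m mP] := ret_gf_approx j x1 e2.
  exists (maxn m n); rewrite !exprS; set a := first_return _ _ _.
  have am : (a <= ret_gf x j + e / 2)%R.
    by apply: le_trans mP; exact: first_return_le (leq_maxl _ _).
  have an : (a ^+ k <= ret_gf x j ^+ k + e / 2)%R.
    apply: le_trans nP; have /andP[a0 _] := w1 (maxn m n) j.
    have /andP[? _] := w1 n j.
    by rewrite lerXn2r ?nnegrE//; exact: first_return_le (leq_maxr _ _).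
  have /andP[a0 a1] := w1 (maxn m n) j; have /andP[b0 b1] := u1 j.
  have bk0 : (0 <= ret_gf x j ^+ k)%R by rewrite exprn_ge0.
  have bk1 : (ret_gf x j ^+ k <= 1)%R by rewrite exprn_ile1.
  rewrite -/a in a0 a1; move: (ret_gf x j) (ret_gf x j ^+ k)%R (a ^+ k)%R am an b0 b1 bk0 bk1.
  move=> b bk ak am an b0 b1 bk0 bk1.
  apply: (@le_trans _ _ (a * (bk + e / 2))%R); first by rewrite ler_wpM2l.
  rewrite mulrDr (le_trans (lerD (ler_wpM2r bk0 am) (ler_wpM2r (ltW e2) a1)))//.
  rewrite mulrDl mul1r -addrA lerD2l.
  have : (e / 2 * bk <= e / 2)%R by rewrite ler_piMr// ltW.
  lra.
rewrite /progeny_prod; elim: (i.+2) c c0 => [|k IH] c c0.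
  by exists 0%N; rewrite !big_ord0 lerDl ltW.
have c2 : (0 < c / 2)%R by rewrite divr_gt0.
have [n nP] := IH _ c2; have [m mP] := approx_pow k (r k) _ c2.
exists (maxn m n); rewrite !big_ord_recr/=.
have lew l : (first_return x (maxn m n) l ^+ r l <= first_return x n l ^+ r l)%R.
  have /andP[a0 _] := w1 (maxn m n) l; have /andP[? _] := w1 n l.
  by rewrite lerXn2r ?nnegrE//; exact: first_return_le (leq_maxr _ _).
have {mP}mP : (first_return x (maxn m n) k ^+ r k <= ret_gf x k ^+ r k + c / 2)%R.
  apply: le_trans mP; have /andP[a0 _] := w1 (maxn m n) k; have /andP[? _] := w1 m k.
  by rewrite lerXn2r ?nnegrE//; exact: first_return_le (leq_maxl _ _).
have {nP}nP : (\prod_(l < k) first_return x (maxn m n) l ^+ r l <=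
    \prod_(l < k) ret_gf x l ^+ r l + c / 2)%R.
  apply: le_trans nP; apply: ler_prod => l _.
  by rewrite lew andbT exprn_ge0//; case/andP: (w1 (maxn m n) l).
have pu (h : nat -> R) : unit_valued h ->
    (0 <= \prod_(l < k) h l ^+ r l <= 1)%R /\ (0 <= h k ^+ r k <= 1)%R.
  move=> h1; have /andP[? ?] := h1 k; rewrite exprn_ge0// exprn_ile1//.
  split => //; rewrite prodr_ge0 => [|l _] /=; last first.
    by rewrite exprn_ge0//; case/andP: (h1 l).
  by apply: Num.Theory.prodr_ile1 => l _; have /andP[? ?] := h1 l; rewrite exprn_ge0//= exprn_ile1.
have [/andP[A0 A1] /andP[a0 a1]] := pu _ (w1 (maxn m n)).
have [/andP[B0 B1] /andP[b0 b1]] := pu _ u1.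
move: A0 A1 a0 a1 B0 B1 b0 b1 nP mP.
set A := (\prod_(l < k) _)%R; set B := (\prod_(l < k) _)%R.
set a := (first_return _ _ _ ^+ _)%R; set b := (ret_gf _ _ ^+ _)%R.
move=> A0 A1 a0 a1 B0 B1 b0 b1 nP mP.
apply: le_trans (ler_wpM2r a0 nP) _.
rewrite mulrDl (le_trans (lerD (ler_wpM2l B0 mP) (ler_wpM2l (ltW c2) a1)))//.
rewrite mulrDr mulr1 -addrA lerD2l.
have : (B * (c / 2) <= c / 2)%R by rewrite ler_piMl// ltW.
lra.
Qed.

Lemma gen_fun_ret_gf_approx x (e : R) j : (0 <= x <= 1)%R -> (0 < e)%R ->
  exists n, (gen_fun (first_return x n) j <= gen_fun (ret_gf x) j + e)%R.
Proof.
move=> x1 e0; apply: (expect_continuous law) => //.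
- by move=> n r _; apply: progeny_prod_unit; exact: first_return_unit.
- by move=> r _; apply: progeny_prod_unit; exact: ret_gf_unit.
- move=> m n r _ mn; apply: le_progeny_prod; first exact: first_return_unit.
  by move=> l; exact: first_return_le.
by move=> r c _; exact: progeny_prod_first_return.
Qed.

Lemma gen_fun_ret_gf x j : (0 <= x <= 1)%R -> j != phi0 ->
  gen_fun (ret_gf x) j = ret_gf x j.
Proof.
move=> x1 jphi; have u1 := ret_gf_unit x1; have w1 m := first_return_unit m x1.
apply/eqP; rewrite eq_le; apply/andP; split.
  apply: ret_gf_ge => n; apply: le_trans (gen_fun_first_return n x1 jphi).
  by apply: le_gen_fun => // l; exact: ret_gf_le.
apply/ler_addgt0Pr => e e0; have [n nP] := gen_fun_ret_gf_approx j x1 e0.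
(* At this index the iterate at [j] is given by [gen_fun], since [j <= maxn n j]. *)
apply: le_trans nP; have := ret_gf_le (maxn n j).+1 j x1.
rewrite /= (negbTE jphi) leq_maxr => /le_trans; apply.
by apply: le_gen_fun => // l; exact: first_return_le (leq_maxl _ _).
Qed.

(** In probabilistic terms E[y^N]^2 <= E[y^(2N)]; it is proved for each iterate and passes to the
    infimum. *)
Lemma ret_gf_sqr y j : (0 <= y <= 1)%R -> (ret_gf y j ^+ 2 <= ret_gf (y ^+ 2) j)%R.
Proof.
move=> y1; have /andP[y0 yle1] := y1.
have y21 : (0 <= y ^+ 2 <= 1)%R by rewrite sqr_ge0 exprn_ile1.
apply: ret_gf_ge => n; apply: (@le_trans _ _ (first_return y n j ^+ 2)%R).
  have /andP[? _] := ret_gf_unit y1 j; have /andP[? _] := first_return_unit n y1 j.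
  by rewrite lerXn2r ?nnegrE//; exact: ret_gf_le.
elim: n j => [|n IH] j /=; first by case: ifP => // _; rewrite expr1n.
case: ifP => // _; case: ifP => _; last by rewrite expr1n.
have w1 := first_return_unit n y1.
apply: le_trans (gen_fun_sqr_ge j w1) _.
by apply: le_gen_fun => //; [exact: unit_valued_sqr|exact: first_return_unit].
Qed.

(* In the first case [h] bounds the extinction probabilities of the process truncated at type
   [k]. In the second one [h j] is a lower bound for the mean of [s ^ N], with [N] the number of
   individuals of type [phi0] in the process started from type [j]. *)
Lemma generating_function_dichotomy :
  (exists k h, [/\ unit_valued h, forall j, (k < j)%N -> h j = 1%R,
     forall j, (gen_fun h j <= h j)%R & (h phi0 < 1)%R]) \/
  (forall e : R, (0 < e)%R -> exists (s : R) (h : nat -> R), [/\ unit_valued h, (1 - e < h phi0)%R,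
     (0 <= s < 1)%R &
     forall j, (h j <= (if j == phi0 then s else 1) * gen_fun h j)%R]).
Proof.
rewrite -implyNp => noA e e0.
(* Otherwise some iterate is a supersolution at [phi0] too; being 1 beyond type [maxn n phi0], it is
   a witness of the first case. *)
have super x : (0 <= x < 1)%R -> (x <= gen_fun (ret_gf x) phi0)%R.
  move=> /andP[x0 x1]; have x01 : (0 <= x <= 1)%R by rewrite x0 ltW.
  rewrite leNgt; apply/negP => fx; apply: noA.
  have d0 : (0 < x - gen_fun (ret_gf x) phi0)%R by rewrite subr_gt0.
  have [n nP] := gen_fun_ret_gf_approx phi0 x01 d0; rewrite subrKC in nP.
  exists (maxn n phi0), (first_return x n); split.
  - exact: first_return_unit.
  - move=> j; rewrite gtn_max => /andP[nj pj].
    case: n nj {nP} => [|n] nj /=; rewrite gtn_eqF// ifF//.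
    by apply/negbTE; rewrite -ltnNge ltnW.
  - move=> j; have [->|jp] := eqVneq j phi0; first by rewrite first_return_phi0.
    exact: gen_fun_first_return.
  by rewrite first_return_phi0.
(* Otherwise [ret_gf x] is a fixed point at all types for every [x] in some interval (a, 1); this
   interval contains both [y] and [y ^+ 2], against [no_squared_fixpoint]. *)
have [x /andP[x0 x1] [ex fx]] : exists2 x, (0 < x < 1)%R &
    (1 - e < x)%R /\ (x < gen_fun (ret_gf x) phi0)%R.
  apply: contrapT => nx; pose a : R := Num.max 0%R (1 - e)%R.
  have a0 : (0 <= a)%R by rewrite le_max lexx.
  have a1 : (a < 1)%R by rewrite gt_max ltr01 ltrBlDr ltrDl.
  have ae : (1 - e <= a)%R by rewrite le_max lexx orbT.
  have fE x : (a < x < 1)%R -> gen_fun (ret_gf x) phi0 = x.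
    move=> /andP[ax x1]; have x0 : (0 < x)%R := le_lt_trans a0 ax.
    apply/eqP; rewrite eq_le super ?(ltW x0)// andbT leNgt; apply/negP => fx.
    by apply: nx; exists x; [rewrite x0|split; [exact: le_lt_trans ax|]].
  pose y : R := ((1 + a) / 2)%R.
  have ay : (a < y)%R by rewrite /y; lra.
  have y1 : (y < 1)%R by rewrite /y; lra.
  have y0 : (0 < y)%R := le_lt_trans a0 ay.
  have ay2 : (a < y ^+ 2)%R.
    have -> : (y ^+ 2 = a + ((1 - a) / 2) ^+ 2)%R by rewrite /y; field.
    by rewrite ltrDl exprn_gt0// divr_gt0// subr_gt0.
  have y21 : (y ^+ 2 < 1)%R by rewrite expr_lt1// ltW.
  have yu : (0 <= y <= 1)%R by rewrite !ltW.
  have y2u : (0 <= y ^+ 2 <= 1)%R by rewrite sqr_ge0 ltW.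
  apply: (@no_squared_fixpoint phi0 (ret_gf (y ^+ 2)) (ret_gf y) y).
  - exact: ret_gf_unit.
  - exact: ret_gf_unit.
  - by rewrite y0.
  - exact: ret_gf_phi0.
  - exact: ret_gf_phi0.
  - by move=> j; exact: ret_gf_sqr.
  - move=> j; have [->|jp] := eqVneq j phi0; last exact: gen_fun_ret_gf.
    by rewrite fE ?ay// ret_gf_phi0.
  - move=> j; have [->|jp] := eqVneq j phi0; last exact: gen_fun_ret_gf.
    by rewrite fE ?ay2// ret_gf_phi0.
have xu : (0 <= x <= 1)%R by rewrite !ltW.
have f0 := lt_trans x0 fx.
exists (x / gen_fun (ret_gf x) phi0)%R, (ret_gf x); split.
- exact: ret_gf_unit.
- by rewrite ret_gf_phi0.
- by rewrite divr_ge0 ?ltW//= ltr_pdivrMr// mul1r.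
move=> j; case: eqP => [->|/eqP jp]; first by rewrite ret_gf_phi0// divfK// gt_eqF.
by rewrite mul1r gen_fun_ret_gf.
Qed.

End GeneratingFunction.

(** * Exploration strategies *)

Definition rank (u : label) : nat := choice.pickle u.

Lemma rank_inj : injective rank.
Proof. exact: pcan_inj choice.pickleK. Qed.

Lemma rank_cons x u : (rank u < rank (x :: u))%N.
Proof.
(* The code of a sequence is a power of 2 given by the head, times an odd number given by the
   tail. *)
change (rank u < 2 ^ choice.pickle x * (rank u).*2.+1)%N.
rewrite (@leq_trans (rank u).*2.+1)//; first by rewrite ltnS -addnn leq_addr.
by rewrite leq_pmull// expn_gt0.
Qed.

Lemma rank_suffix v u : suffix v u -> v != u -> (rank v < rank u)%N.
Proof.
move=> /suffixP[s ->]; case: s => [|x s]; first by rewrite eqxx.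
move=> _; elim: s x => [|y s IH] x; first exact: rank_cons.
exact: ltn_trans (IH y) (rank_cons _ _).
Qed.

Definition label_of_rank (n : nat) : option label := pickle_inv n.

Lemma label_of_rankK u : label_of_rank (rank u) = Some u.
Proof. exact: pickleK_inv. Qed.

Lemma label_of_rank_some n u : label_of_rank n = Some u -> rank u = n.
Proof. by move=> e; have := @pickle_invK label n; rewrite /= -/(label_of_rank n) e. Qed.

Definition labels_below (n : nat) : seq label := pmap label_of_rank (iota 0 n).

Lemma mem_labels_below n u : (u \in labels_below n) = (rank u < n)%N.
Proof.
rewrite mem_pmap; apply/mapP/idP => [[k]|un].
  by rewrite mem_iota add0n => kn /esym/label_of_rank_some ->.
by exists (rank u); rewrite ?mem_iota// label_of_rankK.
Qed.

(* [Ask c k] reveals the progeny vector of the label [c] and continues adaptively with [k]. *)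
Inductive strategy := Halt of bool | Ask of label & (progeny -> strategy).

Fixpoint run (T : Type) (xi : label -> T -> progeny) (s : strategy) (w : T) : bool :=
  match s with Halt b => b | Ask c k => run xi (k (xi c w)) w end.

(** [J] holds the labels already revealed; a label that is asked for joins it, so each answer is
    independent of the past. *)
Fixpoint fresh (J : seq label) (s : strategy) : Prop :=
  if s is Ask c k then c \notin J /\ forall r, fresh (c :: J) (k r) else True.

Lemma sub_fresh J J' s : {subset J' <= J} -> fresh J s -> fresh J' s.
Proof.
elim: s J J' => //= c k IH J J' JJ' [cJ fk]; split; first exact: contra (JJ' c) cJ.
move=> r; apply: IH (fk r) => u; rewrite !inE => /predU1P[->|/JJ' ->].
  by rewrite eqxx.
by rewrite orbT.
Qed.

Section StrategyValue.
Variables (R : realType) (p : nat -> progeny -> R) (phi0 : nat).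
Hypothesis law : is_progeny_law p.

(** This is the probability that the run answers true when each answer is drawn afresh from its
    progeny law. *)
Fixpoint value (s : strategy) : R :=
  match s with
  | Halt b => b%:R
  | Ask c k => expect p (type_of phi0 c) (fun r => value (k r))
  end.

Lemma value_unit s : (0 <= value s <= 1)%R.
Proof.
by elim: s => [[]|c k IH] /=; rewrite ?lexx ?ler01//; apply: expect_le1.
Qed.

End StrategyValue.

(** * Conditioning on revealed progeny vectors *)

Section Exploration.
Context (d : measure_display) (T : measurableType d) (R : realType).
Variables (P : probability T R) (phi0 : nat) (p : nat -> progeny -> R).
Variable xi : label -> T -> progeny.
Hypothesis LHBP : lower_hessenberg_branching phi0 p P xi.

Let law := lhb_law LHBP.

Lemma progeny_range u w : hessenberg (type_of phi0 u) (xi u w).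
Proof. by case: LHBP. Qed.

(** Vectors of [hessenberg i] are coded by their first i + 2 coordinates, hence countably many, and
    countable additivity applies along the values of [f]. *)
Lemma countable_progeny_partition (i : nat) (f : T -> progeny) (E : set T) :
  (forall w, hessenberg i (f w)) ->
  (forall r, hessenberg i r -> measurable (E `&` f @^-1` [set r])) ->
  measurable E /\ P E = \esum_(r in hessenberg i) P (E `&` f @^-1` [set r]).
Proof.
move=> fH mE; pose e (r : progeny) := choice.pickle (map r (iota 0 i.+2)).
have e_inj r s : hessenberg i r -> hessenberg i s -> e r = e s -> r = s.
  move=> hr hs /(pcan_inj choice.pickleK)/eq_in_map rs; apply/funext => l.
  have [li|il] := ltnP l i.+2; first by apply: rs; rewrite mem_iota.
  by rewrite hr// hs.
pose K := e @` hessenberg i.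
pose F n := \bigcup_(r in [set r | hessenberg i r /\ e r = n]) (E `&` f @^-1` [set r]).
have FE r : hessenberg i r -> F (e r) = E `&` f @^-1` [set r].
  move=> hr; apply/seteqP; split=> [w [s [hs /(e_inj _ _ hs hr) <-]]//|w Ew].
  by exists r.
have mF n : K n -> measurable (F n) by move=> [r hr <-]; rewrite FE//; exact: mE.
have EF : E = \bigcup_(n in K) F n.
  apply/seteqP; split=> [w Ew|w [n _ [r _ []]]//].
  by exists (e (f w)); [exists (f w)|rewrite FE].
have mE' : measurable E by rewrite EF; apply: bigcup_measurable => n /mF.
split => //; rewrite {1}EF measure_bigcup//; last first.
  by move=> m n _ _ [w [[r [_ <-] [_ /= <-]] [s [_ <-] [_ /= <-]]]].
rewrite nneseries_esum//.
rewrite (_ : [set x | x \in K] = K); last by apply/seteqP; split=> n /=; rewrite inE.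
rewrite (@reindex_esum _ _ _ (hessenberg i) K e).
  by apply: eq_esum => r hr; rewrite FE.
split => [r hr|r s|n [r hr <-]]; [by exists r| |by exists r].
by rewrite !inE; exact: e_inj.
Qed.

Definition cylinder (J : seq label) (rho : label -> progeny) : set T :=
  [set w | forall u, u \in J -> xi u w = rho u].

Lemma cylinder_cons J rho c r : c \notin J ->
  cylinder (c :: J) (fun u => if u == c then r else rho u) =
  cylinder J rho `&` xi c @^-1` [set r].
Proof.
move=> cJ; apply/seteqP; split=> [w Cw|w [Cw cr] u].
  split=> [u uJ|]; last by rewrite /= Cw ?mem_head// eqxx.
  have := Cw u; rewrite inE uJ orbT => /(_ isT) ->.
  by case: eqP uJ cJ => // -> ->.
by rewrite inE; case: eqP => [->|_ /= /Cw].
Qed.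

Lemma cylinderE J rho : cylinder J rho =
  \bigcap_(u in [set` [fset v in J]%fset]) (xi u @^-1` [set rho u]).
Proof.
by apply/seteqP; split=> w Cw u; move: (Cw u) => /=; rewrite !inE.
Qed.

Lemma measurable_cylinder J rho : measurable (cylinder J rho).
Proof.
rewrite cylinderE bigcap_fset; apply: bigsetI_measurable => u _.
exact: lhb_measurable LHBP u (rho u).
Qed.

Lemma cylinder_independent J rho c r : c \notin J -> hessenberg (type_of phi0 c) r ->
  P (cylinder J rho `&` xi c @^-1` [set r]) =
  P (cylinder J rho) * (p (type_of phi0 c) r)%:E.
Proof.
move=> cJ hr; rewrite -cylinder_cons//; set rho' := fun u => _.
have rho'E u : u \in J -> rho' u = rho u.
  by rewrite /rho'; case: eqP => // -> uJ; rewrite uJ in cJ.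
rewrite !cylinderE !(lhb_independent LHBP).
have -> : [fset v in c :: J]%fset = (c |` [fset v in J])%fset.
  by apply/fsetP => u; rewrite !inE.
rewrite big_fsetU1/=; last by rewrite !inE.
rewrite muleC; congr (_ * _).
  by apply: eq_big_seq => u; rewrite !inE => uJ; rewrite rho'E.
by rewrite /rho' eqxx (lhb_distribution LHBP).
Qed.

(** The condition on [A] makes it contain the cylinder or miss it; then, by induction on the
    strategy, each answer extends the cylinder by a label independent of it. *)
Lemma run_cylinder J rho s (A : set T) :
  fresh J s -> (forall w w', cylinder J rho w -> cylinder J rho w' -> A w -> A w') ->
  measurable (cylinder J rho `&` A `&` [set w | run xi s w]) /\
  P (cylinder J rho `&` A `&` [set w | run xi s w]) =
    P (cylinder J rho `&` A) * (value p phi0 s)%:E.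
Proof.
move=> fs Aconst; have [[w0 [Cw0 Aw0]]|noA] := pselect (cylinder J rho `&` A !=set0);
  last first.
  have -> : cylinder J rho `&` A = set0 by apply: contrapT => /eqP/set0P/noA.
  by rewrite set0I measure0 mul0e; split; first exact: measurable0.
have -> : cylinder J rho `&` A = cylinder J rho.
  by apply/seteqP; split=> [w []//|w Cw]; split => //; exact: Aconst Aw0.
elim: s J rho fs {A Aconst w0 Cw0 Aw0} => [b|c k IH] J rho /=.
  move=> _; case: b.
    rewrite (_ : [set w | true] = setT) ?setIT ?mule1//; last exact/seteqP.
    by split => //; exact: measurable_cylinder.
  rewrite (_ : [set w | false] = set0) ?setI0 ?measure0 ?mulr0n ?mule0//; last by apply/seteqP; split.
move=> [cJ fk]; set E := (X in measurable X).
pose rho' r u := if u == c then r else rho u.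
have EE r : E `&` xi c @^-1` [set r] =
    cylinder (c :: J) (rho' r) `&` [set w | run xi (k r) w].
  rewrite cylinder_cons//; apply/seteqP; split=> w /=.
    by move=> [[? +] <-].
  by move=> [[? <-]].
have [|mE PE] := @countable_progeny_partition (type_of phi0 c) (xi c) E
  (@progeny_range c).
  by move=> r hr; rewrite EE; case: (IH r _ (rho' r) (fk r)).
split => //; rewrite PE.
transitivity (\esum_(r in hessenberg (type_of phi0 c))
   (fine (P (cylinder J rho)) * (p (type_of phi0 c) r * value p phi0 (k r)))%:E).
  apply: eq_esum => r hr; rewrite EE; have [_ ->] := IH r _ (rho' r) (fk r).
  rewrite cylinder_cons// cylinder_independent// 2!EFinM muleA fineK//.
  by rewrite fin_num_measure//; exact: measurable_cylinder.
have bv : bounded_progeny_fun (type_of phi0 c) (fun r => value p phi0 (k r)).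
  by apply: bounded_unit => r _; exact: value_unit.
have P0 : (0 <= fine (P (cylinder J rho)))%R by exact: fine_ge0.
under eq_esum do rewrite mulrCA.
rewrite (expect_esum law); last exact: boundedZ.
rewrite expectZ// EFinM fineK//.
by rewrite fin_num_measure//; exact: measurable_cylinder.
Qed.

Definition agree_below (n : nat) (w w' : T) : Prop :=
  forall u, (rank u < n)%N -> xi u w = xi u w'.

(** This stands for membership in the sigma-algebra of the labels of rank below [n]; measurability
    follows, as finitely many labels take countably many joint values. *)
Definition determined_below (n : nat) (A : set T) : Prop :=
  forall w w', agree_below n w w' -> A w -> A w'.

Lemma agree_below_sym n w w' : agree_below n w w' -> agree_below n w' w.
Proof. by move=> ww' u /ww'. Qed.

Lemma agree_below_le m n w w' : (m <= n)%N -> agree_below n w w' -> agree_below m w w'.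
Proof. by move=> mn ww' u um; apply: ww'; exact: leq_trans mn. Qed.

Lemma determined_run_le n s A : fresh (labels_below n) s -> determined_below n A ->
  measurable (A `&` [set w | run xi s w]) /\
  P (A `&` [set w | run xi s w]) <= (value p phi0 s)%:E * P A.
Proof.
move=> fs dA.
(* [J] holds the labels whose values are fixed by [rho], [J0] those still to be fixed, one at each
   induction step. *)
suff key J0 J rho : {subset labels_below n <= J0 ++ J} -> fresh (J0 ++ J) s ->
    [/\ measurable (cylinder J rho `&` A),
        measurable (cylinder J rho `&` A `&` [set w | run xi s w]) &
        P (cylinder J rho `&` A `&` [set w | run xi s w]) <=
          (value p phi0 s)%:E * P (cylinder J rho `&` A)].
  have [||] := key (labels_below n) [::] (fun _ _ => 0%N); rewrite ?cats0//.
  have -> : cylinder [::] (fun _ _ => 0%N) = setT by apply/seteqP.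
  by rewrite setTI.
elim: J0 J rho => [|c J0 IH] J rho sub fJ.
  have Ac w w' : cylinder J rho w -> cylinder J rho w' -> A w -> A w'.
    move=> Cw Cw'; apply: dA => u un; have uJ : u \in J.
      by apply: (sub u); rewrite mem_labels_below.
    by rewrite Cw// Cw'.
  have [? ->] := run_cylinder fJ Ac.
  have [mt _] := run_cylinder (J := J) (s := Halt true) I Ac.
  split; rewrite 1?muleC//.
  by move: mt; rewrite (_ : [set w | _] = setT) ?setIT//; exact/seteqP.
have [cJ|cJ] := boolP (c \in J).
  apply: IH; last first.
    by apply: sub_fresh fJ => u; rewrite !inE => ->; rewrite orbT.
  move=> u /sub; rewrite !mem_cat inE => /orP[/predU1P[->|->//]|->].
    by rewrite cJ orbT.
  by rewrite orbT.
pose rho' r u := if u == c then r else rho u.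
have {}IH r : [/\ measurable (cylinder J rho `&` A `&` xi c @^-1` [set r]),
    measurable (cylinder J rho `&` A `&` [set w | run xi s w] `&` xi c @^-1` [set r]) &
    P (cylinder J rho `&` A `&` [set w | run xi s w] `&` xi c @^-1` [set r]) <=
    (value p phi0 s)%:E * P (cylinder J rho `&` A `&` xi c @^-1` [set r])].
  have [||] := IH (c :: J) (rho' r).
  - by move=> u /sub; rewrite !mem_cat !inE; case: (u == c); case: (u \in J0).
  - apply: sub_fresh fJ => u; rewrite !mem_cat !inE.
    by case: (u == c); case: (u \in J0).
  rewrite cylinder_cons//.
  by rewrite (setIAC (cylinder J rho)) (setIAC _ (xi c @^-1` [set r]) [set w | run xi s w]).
have hc w0 := @progeny_range c w0.
have [|m1 e1] := countable_progeny_partition (E := cylinder J rho `&` A) hc.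
  by move=> r _; case: (IH r).
have [|m2 e2] := countable_progeny_partition
    (E := cylinder J rho `&` A `&` [set w | run xi s w]) hc.
  by move=> r _; case: (IH r).
split => //; rewrite e2 e1.
have /andP[v0 _] := value_unit phi0 law s.
pose a r := fine (P (cylinder J rho `&` A `&` xi c @^-1` [set r])).
have aE r : P (cylinder J rho `&` A `&` xi c @^-1` [set r]) = (a r)%:E.
  by rewrite fineK// fin_num_measure//; case: (IH r).
rewrite [leRHS](_ : _ = (value p phi0 s)%:E *
  \esum_(r in hessenberg (type_of phi0 c)) (a r)%:E); last first.
  by congr (_ * _); apply: eq_esum => r _; rewrite aE.
apply: le_trans (le_esumZl v0 _); last by move=> r _; exact: fine_ge0.
by apply: le_esum => r _; rewrite EFinM -aE; case: (IH r).
Qed.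

Lemma determined_measurable n A : determined_below n A -> measurable A.
Proof.
move=> /(determined_run_le (s := Halt true) I)[+ _].
by rewrite (_ : [set w | _] = setT) ?setIT//; exact/seteqP.
Qed.

End Exploration.

(** * Repeated trials *)

Section Trials.
Context (d : measure_display) (T : measurableType d) (R : realType).
Variables (P : probability T R) (phi0 : nat) (p : nat -> progeny -> R).
Variable xi : label -> T -> progeny.
Hypothesis LHBP : lower_hessenberg_branching phi0 p P xi.

Lemma in_tree_agree u w w' : agree_below xi (rank u) w w' ->
  in_tree xi w u -> in_tree xi w' u.
Proof.
elim: u => //= x v IH ww' [tv xv]; split.
  by apply: IH tv; exact: agree_below_le (ltnW (rank_cons x v)) ww'.
by rewrite -ww'// rank_cons.
Qed.

Lemma negligible_of_small_covers (B : set T) :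
  (forall e : R, (0 < e)%R -> exists A, [/\ measurable A, B `<=` A & P A <= e%:E]) ->
  P.-negligible B.
Proof.
move=> small; have e0 n : (0 < n.+1%:R^-1 :> R)%R by rewrite invr_gt0.
pose A n := projT1 (cid (small _ (e0 n))).
have AP n : [/\ measurable (A n), B `<=` A n & P (A n) <= (n.+1%:R^-1)%:E].
  by rewrite /A; case: cid.
have mA : measurable (\bigcap_n A n).
  by apply: bigcapT_measurable => n; case: (AP n).
exists (\bigcap_n A n); split => //; last by move=> w Bw n _; case: (AP n) => _ /(_ _ Bw).
apply/eqP; rewrite eq_le measure_ge0 andbT; apply/lee_addgt0Pr => e eg0; rewrite add0e.
have [n ne] : exists n, (n.+1%:R^-1 <= e)%R.
  exists (Num.truncn e^-1); rewrite invf_ple ?posrE//.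
  by apply: ltW; rewrite truncnS_gt.
apply: (@le_trans _ _ (P (A n))); last by case: (AP n) => _ _ /le_trans; apply; rewrite lee_fin.
by apply: le_measure; rewrite ?inE//; [case: (AP n)|move=> w /(_ n I)].
Qed.

(** [g] selects the labels that start a trial, [D N u] says that the trial at [u] is seen to fail
    from the labels of rank below [N], and [q] bounds the failure probability given the labels
    before [u]. *)
Variables (g : label -> Prop) (D : nat -> label -> set T) (q : R).
Hypothesis q01 : (0 <= q < 1)%R.
Hypothesis D_incr : forall N u, D N u `<=` D N.+1 u.
Hypothesis D_det : forall N u, determined_below xi N (D N u).
Hypothesis D_le : forall N u X, g u -> determined_below xi (rank u) X ->
  P (X `&` D N u) <= q%:E * P X.

Let candidate (w : T) (u : label) := in_tree xi w u /\ g u.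

Let B := [set w | (forall n, exists u, (n <= rank u)%N /\ candidate w u) /\
                  forall u, candidate w u -> exists N, D N u w].

(** The sets grow with the rank explored, so a point of [B] enters the cover at a finite time, after
    which a new trial can be placed. *)
Let cover (x : R) := exists S : nat -> set T,
  [/\ forall N, S N `<=` S N.+1, forall N, determined_below xi N (S N),
      forall N, P (S N) <= x%:E & B `<=` \bigcup_N S N].

Let incr_le (S : nat -> set T) m n : (forall N, S N `<=` S N.+1) -> (m <= n)%N ->
  S m `<=` S n.
Proof.
move=> Sincr /subnK <-; elim: (n - m)%N => // k IH.
by rewrite addSn; exact: subset_trans IH (Sincr _).
Qed.

Let D_le_incr m n u : (m <= n)%N -> D m u `<=` D n u.
Proof. by apply: (@incr_le (fun k => D k u)) => k; exact: D_incr. Qed.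

(* A point that entered the cover at time [n] makes its next trial at the first candidate
   of rank at least [n]; the new cover keeps the points whose trial fails. *)
Let cover_step x : cover x -> cover (q * x)%R.
Proof.
move=> [S [Sincr Sdet SP BS]]; have /andP[q0 q1] := q01.
pose entry n w := S n w /\ forall m, (m < n)%N -> ~ S m w.
have entry_inj m n w : entry m w -> entry n w -> m = n.
  move=> [Sm mS] [Sn nS]; case: (ltngtP m n) => //; first by move/nS.
  by move/mS.
pose trial v := [set w | exists n, [/\ entry n w, (n <= rank v)%N, candidate w v &
  forall u, (n <= rank u < rank v)%N -> ~ candidate w u]].
have cand_det u : determined_below xi (rank u) (candidate ^~ u).
  by move=> w w' ww' [/(in_tree_agree ww')].
have trial_det v : determined_below xi (rank v) (trial v).
  move=> w w' ww' [n [[Sn nS] nv cv first_v]]; exists n; split => //.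
  - split; first exact: Sdet (agree_below_le nv ww') Sn.
    move=> m mn Sm; apply: (nS m mn); apply: Sdet Sm; apply: agree_below_sym.
    by apply: agree_below_le ww'; exact: leq_trans (ltnW mn) nv.
  - exact: cand_det ww' cv.
  move=> u /andP[nu uv] /(cand_det _ _ _ (agree_below_le (ltnW uv) (agree_below_sym ww'))).
  by apply: first_v; rewrite nu.
have trial_inj u v w : trial u w -> trial v w -> rank u = rank v.
  move=> [m [em mu cu fu]] [n [en nv cv fv]].
  have mn := entry_inj _ _ _ em en; subst n.
  case: (ltngtP (rank u) (rank v)) => // uv; first by case: (fv u) => //; rewrite mu.
  by case: (fu v) => //; rewrite nv.
have trial_S v N : (rank v < N)%N -> trial v `<=` S N.
  by move=> vN w [n [[+ _] nv _ _]]; apply: incr_le => //; lia.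
have [mS mtrial] : (forall N, measurable (S N)) /\ (forall v, measurable (trial v)).
  split => [N|v]; first exact: (determined_measurable LHBP) (Sdet N).
  exact: (determined_measurable LHBP) (trial_det v).
have mD N v : measurable (D N v) := determined_measurable LHBP (@D_det N v).
exists (fun N => [set w | exists v, [/\ (rank v < N)%N, trial v w & D N v w]]).
split.
- by move=> N w [v [vN tv Dv]]; exists v; split => //; [exact: ltnW|exact: D_incr].
- move=> N w w' ww' [v [vN tv Dv]]; exists v; split => //.
    by apply: trial_det tv; exact: agree_below_le (ltnW vN) ww'.
  exact: D_det ww' Dv.
- move=> N; set S' := (X in P X).
  have S'det : determined_below xi N S'.
    move=> w w' ww' [v [vN tv Dv]]; exists v; split => //.
      by apply: trial_det tv; exact: agree_below_le (ltnW vN) ww'.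
    exact: D_det ww' Dv.
  (* Indexed by rank, the trials placed before [N] are finitely many disjoint events inside [S N],
     and each keeps at most a fraction [q]. *)
  pose Y (t : nat) := if label_of_rank t is Some v then trial v else set0.
  pose Z' (t : nat) := if label_of_rank t is Some v then trial v `&` D N v else set0.
  have mY t : measurable (Y t) by rewrite /Y; case: label_of_rank.
  have mZ t : measurable (Z' t).
    by rewrite /Z'; case: label_of_rank => // v; exact: measurableI.
  have YN (t : 'I_N) : Y t `<=` S N.
    rewrite /Y; case e : label_of_rank => [v|]; last exact: sub0set.
    by apply: trial_S; rewrite (label_of_rank_some e).
  have tY : trivIset [set: 'I_N] (fun t => Y t).
    move=> a b _ _ [w [Ya Yb]]; apply/ord_inj; move: Ya Yb; rewrite /Y.
    case ea : label_of_rank => [u|//]; case eb : label_of_rank => [v|//] tu tv.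
    by rewrite -(label_of_rank_some ea) -(label_of_rank_some eb); exact: trial_inj tu tv.
  have mYU : measurable (\big[setU/set0]_(t < N) Y t) by exact: bigsetU_measurable.
  apply: (@le_trans _ _ (\sum_(t < N) P (Z' t))).
    apply: content_subadditive => //; first exact: (determined_measurable LHBP) S'det.
    move=> w [v [vN tv Dv]]; rewrite -bigcup_mkord; exists (rank v) => //.
    by rewrite /Z' label_of_rankK.
  apply: (@le_trans _ _ (\sum_(t < N) q%:E * P (Y t))).
    apply: lee_sum => t _; rewrite /Z' /Y; case: label_of_rank => [v|]; last first.
      by rewrite measure0 mule0.
    have [gv|ngv] := pselect (g v); first exact: D_le.
    rewrite (_ : trial v = set0) ?set0I ?measure0 ?mule0//.
    by apply/seteqP; split=> // w [n [_ _ [_ /ngv]]].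
  rewrite -ge0_sume_distrr// -measure_bigsetU_ord// EFinM lee_wpmul2l ?lee_fin//.
  apply: le_trans (SP N); apply: le_measure; rewrite ?inE//.
  by rewrite -bigcup_mkord => w [t tN]; exact: (YN (Ordinal tN)).
(* Infinitely many candidates provide one after the entry time, and by definition of [B] its trial
   fails. *)
move=> w Bw; have [N0 _ SN0] := BS w Bw; have [inf_cand Dw] := Bw.
have [n en] : exists n, entry n w.
  have exS : exists n, `[< S n w >] by exists N0; apply/asboolP.
  exists (ex_minn exS); case: ex_minnP => n /asboolP Sn nmin; split => // m mn Sm.
  by have := nmin m; rewrite leqNgt mn => /(_ (asboolT Sm)).
have [v [nv cv fv]] : exists v, [/\ (n <= rank v)%N, candidate w v &
    forall u, (n <= rank u < rank v)%N -> ~ candidate w u].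
  pose Q m := `[< exists u, [/\ rank u = m, (n <= m)%N & candidate w u] >].
  have exQ : exists m, Q m.
    by have [u [nu cu]] := inf_cand n; exists (rank u); apply/asboolP; exists u.
  case: (ex_minnP exQ) => m /asboolP[v [vm nm cv]] mmin; exists v; rewrite vm.
  split => // u /andP[nu um] cu.
  have := mmin (rank u); rewrite leqNgt um => /(_ _)/negP; apply => //.
  by apply/asboolP; exists u.
have [N DN] := Dw v cv.
exists (maxn N (rank v).+1) => //; exists v; split; first by rewrite leq_maxr.
  by exists n.
exact: D_le_incr (leq_maxl _ _) _ DN.
Qed.

Lemma trials_negligible : P.-negligible B.
Proof.
have /andP[q0 q1] := q01.
have coverX m : cover (q ^+ m)%R.
  elim: m => [|m IH]; last by rewrite exprS; exact: cover_step.
  exists (fun=> setT); split => // [N|w _]; last by exists 0%N.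
  by rewrite expr0; exact: probability_le1.
apply: negligible_of_small_covers => e e0.
have [m qm] : exists m, (q ^+ m <= e)%R.
  have : (q ^+ n @[n --> \oo] --> (0 : R))%R by apply: cvg_expr; rewrite ger0_norm.
  move=> /cvgrPdist_le/(_ e e0)[m _ /(_ m (leqnn m))]; rewrite sub0r normrN.
  by rewrite ger0_norm ?exprn_ge0//; exists m.
have [S [Sincr Sdet SP BS]] := coverX m.
have mS N : measurable (S N) := determined_measurable LHBP (Sdet N).
have mU : measurable (\bigcup_N S N) by exact: bigcupT_measurable.
exists (\bigcup_N S N); split => //.
apply: (cvge_to_le (nondecreasing_cvg_mu mS mU _)).
  by move=> i j ij; apply/subsetPset; exact: incr_le.
by apply: nearW => N /=; apply: le_trans (SP N) _; rewrite lee_fin.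
Qed.

End Trials.

(** * Recurrence along paths of types *)

(** This is infinitude, as only finitely many labels lie below a given rank. *)
Definition unbounded (A : label -> Prop) : Prop :=
  forall n, exists u, (n <= rank u)%N /\ A u.

Lemma sub_unbounded (A A' : label -> Prop) :
  (forall u, A u -> A' u) -> unbounded A -> unbounded A'.
Proof. by move=> AA' uA n; have [u [nu /AA']] := uA n; exists u. Qed.

(** Pigeonhole principle: beyond the largest of k + 1 bounds no label of [A] would be left. *)
Lemma unbounded_finite_cover (A : label -> Prop) (f : label -> nat) (k : nat) :
  (forall u, A u -> (f u <= k)%N) -> unbounded A ->
  exists2 i, (i <= k)%N & unbounded (fun u => A u /\ f u = i).
Proof.
move=> fk uA; apply: contrapT => noi.
have bnd i : exists n, (i <= k)%N -> forall u, (n <= rank u)%N -> ~ (A u /\ f u = i).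
  have [ik|_] := leqP i k; last by exists 0%N.
  have /existsNP[n /forallNP nP] : ~ unbounded (fun u => A u /\ f u = i).
    by move=> ui; apply: noi; exists i.
  by exists n => _ u nu Au; apply: (nP u).
pose N i := projT1 (cid (bnd i)).
have [u [Nu Au]] := uA (\max_(i < k.+1) N i).
have fuk := fk _ Au.
apply: (projT2 (cid (bnd (f u))) fuk u) => //.
apply: leq_trans Nu.
exact: (@leq_bigmax _ (fun i : 'I_k.+1 => N i) (Ordinal (fuk : (f u < k.+1)%N))).
Qed.

(** The child numbered 0 of a type exists as soon as there is any child of that type. *)
Definition descend (s : seq nat) (u : label) : label :=
  foldl (fun v t => (t, 0%N) :: v) u s.

Lemma rank_descend s u : (rank u <= rank (descend s u))%N.
Proof.
elim: s u => //= t s IH u; apply: leq_trans (IH _); exact: ltnW (rank_cons _ _).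
Qed.

Lemma type_of_descend phi0 s u :
  type_of phi0 (descend s u) = last (type_of phi0 u) s.
Proof. by elim: s u => //= t s IH u; rewrite IH. Qed.

Lemma suffix_cons_inv (x : nat * nat) (u v : label) :
  suffix v (x :: u) -> v = x :: u \/ suffix v u.
Proof.
by move=> /suffixP[[|y s] [e]]; [left|right; apply/suffixP; exists s; case: e].
Qed.

(* The run succeeds iff the line of first children of the successive types [s] below [u]
   breaks off. *)
Fixpoint path_failure (s : seq nat) (u : label) : strategy :=
  if s is t :: s' then
    Ask u (fun r => if (0 < r t)%N then path_failure s' ((t, 0%N) :: u) else Halt true)
  else Halt false.

Section PathRecurrence.
Context (d : measure_display) (T : measurableType d) (R : realType).
Variables (P : probability T R) (phi0 : nat) (p : nat -> progeny -> R).
Variable xi : label -> T -> progeny.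
Hypothesis LHBP : lower_hessenberg_branching phi0 p P xi.

Let law := lhb_law LHBP.

Lemma fresh_path_failure J s u : (forall v, v \in J -> (rank v < rank u)%N) ->
  fresh J (path_failure s u).
Proof.
elim: s J u => //= t s IH J u Ju; split.
  by apply/negP => /Ju; rewrite ltnn.
move=> r; case: ifP => // _; apply: IH => v; rewrite inE => /predU1P[->|/Ju vu].
  exact: rank_cons.
exact: ltn_trans vu (rank_cons _ _).
Qed.

Lemma path_failure_determined s u w w' :
  agree_below xi (rank (descend s u)) w w' ->
  run xi (path_failure s u) w -> run xi (path_failure s u) w'.
Proof.
elim: s u => //= t s IH u ww'; rewrite -ww'; last first.
  exact: leq_trans (rank_cons _ _) (rank_descend _ _).
by case: ifP => // _; exact: IH.
Qed.

Lemma path_failureP s u w : in_tree xi w u -> ~ run xi (path_failure s u) w ->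
  in_tree xi w (descend s u).
Proof.
elim: s u => //= t s IH u tu; case: ifP => // rt /IH; apply; split => //.
Qed.

(** The probability that the line breaks off depends only on the type it starts from, so the failure
    bound is uniform over labels. *)
Fixpoint path_value (i : nat) (s : seq nat) : R :=
  if s is t :: s' then
    expect p i (fun r => if (0 < r t)%N then path_value t s' else 1%R)
  else 0%R.

Lemma path_failure_value s u :
  value p phi0 (path_failure s u) = path_value (type_of phi0 u) s.
Proof.
elim: s u => //= t s IH u; apply: eq_expect => r _.
by case: ifP => // _; rewrite IH.
Qed.

Lemma path_value_unit i s : (0 <= path_value i s <= 1)%R.
Proof.
elim: s i => [|t s IH] i /=; first by rewrite lexx ler01.
by apply: (expect_le1 law) => r _; case: ifP => // _; rewrite ler01 lexx.
Qed.

Lemma path_value_lt1 i s : path (fun a b => 0 < mean_progeny p a b) i s ->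
  (path_value i s < 1)%R.
Proof.
elim: s i => [|t s IH] i /=; first by rewrite ltr01.
move=> /andP[/(mean_gt0_progeny law)[r [hr pr rt]] /IH vt].
apply: (expect_lt1 law _ hr pr); last by rewrite rt.
by move=> r' _; case: ifP => // _; [exact: path_value_unit|rewrite ler01 lexx].
Qed.

Lemma path_recurrence (g : label -> Prop) i s :
  path (fun a b => 0 < mean_progeny p a b) i s ->
  (forall u, g u -> type_of phi0 u = i) ->
  {ae P, forall w, unbounded (fun u => in_tree xi w u /\ g u) ->
     unbounded (fun u => [/\ in_tree xi w u, g u & in_tree xi w (descend s u)])}.
Proof.
move=> ps gi.
(* The bound on the rank makes [D N u] depend on labels below [N] only; a failure is recorded late,
   but in finite time. *)
pose D N u := [set w | (rank (descend s u) <= N)%N /\ run xi (path_failure s u) w].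
(* Trials restricted to ranks at least [n] give a success beyond each [n], hence infinitely many. *)
suff neg n : P.-negligible [set w | unbounded (fun u => in_tree xi w u /\ g u) /\
    forall u, (n <= rank u)%N -> in_tree xi w u -> g u -> run xi (path_failure s u) w].
  apply: (@negligibleS _ _ _ _ _ _ _ (negligible_bigcup neg)).
  move=> w /not_implyP[ub /existsNP[n /forallNP nP]]; exists n => //; split => // u nu tu gu.
  by apply: contrapT => /(path_failureP tu) ds; apply: (nP u).
have q01 : (0 <= path_value i s < 1)%R.
  by rewrite path_value_lt1// andbT; case/andP: (path_value_unit i s).
apply: (@negligibleS _ _ _ _ _ _ _
  (@trials_negligible _ _ _ _ _ _ _ LHBP (fun u => g u /\ (n <= rank u)%N) D _ q01 _ _ _)).
- move=> w [ub fail]; split=> [m|u [tu [gu nu]]]; last first.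
    by exists (rank (descend s u)); split => //; exact: fail.
  have [u [mu [tu gu]]] := ub (maxn m n); move: mu; rewrite geq_max => /andP[? ?].
  by exists u.
- by move=> N u w [uN rw]; split => //; exact: leqW.
- move=> N u w w' ww' [uN rw]; split => //.
  by apply: path_failure_determined rw; exact: agree_below_le ww'.
move=> N u X [gu _] dX.
have [uN|Nu] := leqP (rank (descend s u)) N; last first.
  rewrite (_ : D N u = set0) ?setI0 ?measure0.
    by rewrite mule_ge0// lee_fin; case/andP: q01.
  by apply/seteqP; split => // w []; rewrite leqNgt Nu.
have -> : D N u = [set w | run xi (path_failure s u) w].
  by apply/seteqP; split=> [w []//|w]; split.
rewrite -(gi _ gu) -path_failure_value.
have fr : fresh (labels_below (rank u)) (path_failure s u).
  by apply: fresh_path_failure => v; rewrite mem_labels_below.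
by case: (determined_run_le LHBP fr dX).
Qed.

(** Together with [in_tree] this is membership in the tree where types above [k] are sterile; [u]
    itself may exceed [k]. *)
Definition types_below (k : nat) (u : label) : Prop :=
  forall v, suffix v u -> v != u -> (type_of phi0 v <= k)%N.

Lemma types_below_descend k i n u : type_of phi0 u = i -> (i + n = k.+1)%N ->
  types_below k u -> types_below k (descend (iota i.+1 n) u).
Proof.
elim: n i u => //= n IH i u ti ink bu; apply: (IH i.+1) => //; first by lia.
move=> v /suffix_cons_inv[->|]; first by rewrite eqxx.
have [->|vu] := eqVneq v u; first by rewrite ti => *; lia.
by move=> /bu/(_ vu).
Qed.

Hypothesis up : forall i : nat, 0 < mean_progeny p i i.+1.

(** Some type [i <= k] occurs infinitely often, and the line of types i + 1, ..., k + 1 leaves the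
    types up to [k] only at its end. *)
Lemma sterile_tree_records : {ae P, forall w (k : nat),
  unbounded (fun u => [/\ in_tree xi w u, types_below k u & (type_of phi0 u <= k)%N]) ->
  unbounded (fun u => [/\ in_tree xi w u, types_below k u & type_of phi0 u = k.+1])}.
Proof.
suff key k i : {ae P, forall w, (i <= k)%N ->
    unbounded (fun u => in_tree xi w u /\ (types_below k u /\ type_of phi0 u = i)) ->
    unbounded (fun u => [/\ in_tree xi w u, types_below k u & type_of phi0 u = k.+1])}.
  have {}key := ae_foralln (fun k => ae_foralln (key k)).
  apply: filterS key => w key k /(unbounded_finite_cover (f := type_of phi0)).
  move=> /(_ k)[u []//|i ik ui].
  apply: (key k i ik); apply: sub_unbounded ui => u [[tu bu _] ui].
  by split.
have [ik|ki] := leqP i k; last exact: aeW.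
have ps j n : path (fun a b => 0 < mean_progeny p a b) j (iota j.+1 n).
  by elim: n j => //= n IH j; rewrite up IH.
apply: filterS (path_recurrence (g := fun u => types_below k u /\ type_of phi0 u = i)
  (ps i (k.+1 - i)%N) _).
  move=> w rec _ /rec {}rec n; have [u [nu [tu [bu ui] du]]] := rec n.
  exists (descend (iota i.+1 (k.+1 - i)) u); split.
    exact: leq_trans nu (rank_descend _ _).
  split => //; first by apply: types_below_descend => //; lia.
  rewrite type_of_descend ui (last_nth 0%N) size_iota.
  case e : (k.+1 - i)%N => [|m]; first by lia.
  by rewrite -[LHS]/(nth 0%N (iota i.+1 m.+1) m) nth_iota//; lia.
by move=> u [].
Qed.

Hypothesis irr : irreducible p.

Lemma type_recurrence : {ae P, forall w l,
  unbounded (fun u => in_tree xi w u /\ type_of phi0 u = l) ->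
  unbounded (fun u => in_tree xi w u /\ type_of phi0 u = phi0)}.
Proof.
apply: ae_foralln => l; have [s [ps sphi]] := irr l phi0.
apply: filterS (path_recurrence (g := fun u => type_of phi0 u = l) ps (fun=> id)).
move=> w rec /rec {}rec n; have [u [nu [tu ul du]]] := rec n.
exists (descend s u); split; first exact: leq_trans nu (rank_descend _ _).
by rewrite type_of_descend ul.
Qed.

End PathRecurrence.

(** * Exploration in the order of the ranks *)

Definition kids (keep : pred nat) (phi0 : nat) (c : label) (r : progeny) : seq label :=
  flatten (map (fun l => map (fun m => (l, m) :: c) (iota 0 (r l)))
    (seq.filter keep (iota 0 (type_of phi0 c).+2))).

Lemma mem_kids (keep : pred nat) phi0 c r v : v \in kids keep phi0 c r ->
  exists x, [/\ v = x :: c, keep x.1 & (x.2 < r x.1)%N].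
Proof.
move=> /flatten_mapP[l]; rewrite mem_filter => /andP[kl _] /mapP[m].
by rewrite mem_iota => /andP[_ mr] ->; exists (l, m).
Qed.

Lemma kids_mem (keep : pred nat) phi0 c r x : hessenberg (type_of phi0 c) r -> keep x.1 ->
  (x.2 < r x.1)%N -> x :: c \in kids keep phi0 c r.
Proof.
case: x => l m /= hr kl mr; apply/flatten_mapP; exists l; last first.
  by apply/mapP; exists m; rewrite ?mem_iota.
rewrite mem_filter kl mem_iota /= ltnNge.
by apply: contraL mr => /hr ->.
Qed.

Lemma kids_uniq keep phi0 c r : uniq (kids keep phi0 c r).
Proof.
have : uniq (seq.filter keep (iota 0 (type_of phi0 c).+2)) by rewrite filter_uniq ?iota_uniq.
rewrite /kids; elim: (seq.filter _ _) => //= l s IH /andP[ls us].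
rewrite cat_uniq IH// andbT map_inj_uniq ?iota_uniq/=; last by move=> m n [].
apply/hasPn => v /flatten_mapP[l' l's /mapP[m _ ->]].
by apply/mapP => -[n _ [e _]]; rewrite -e l's in ls.
Qed.

(* Goes through the ranks [t], ..., [t + n - 1]. [V] holds the explored labels and [L] the
   unexplored ones with an explored parent; as parents precede their children, each label of the
   tree is in [L] when its rank comes. *)
Fixpoint sweep (keep : pred nat) (phi0 : nat) (fin : seq label -> seq label -> bool)
    (n t : nat) (V L : seq label) : strategy :=
  if n is n'.+1 then
    if label_of_rank t is Some c then
      if c \in L then
        Ask c (fun r => sweep keep phi0 fin n' t.+1 (c :: V) (rem c L ++ kids keep phi0 c r))
      else sweep keep phi0 fin n' t.+1 V L
    else sweep keep phi0 fin n' t.+1 V L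
  else Halt (fin V L).

(** Invariant of [L] at time [t]: no member has been passed over, and parents have ranks already
    passed, so the children of the next label explored are not yet in [L]. *)
Definition frontier (t : nat) (L : seq label) : Prop :=
  [/\ uniq L, forall v, v \in L -> (t <= rank v)%N &
      forall x c, x :: c \in L -> (rank c < t)%N].

Lemma frontier_root u : frontier (rank u) [:: u].
Proof.
split => // [v|x c]; rewrite inE => /eqP; first by move->.
by move=> <-; exact: rank_cons.
Qed.

Lemma frontier_ask keep phi0 c r L : frontier (rank c) L -> c \in L ->
  frontier (rank c).+1 (rem c L ++ kids keep phi0 c r).
Proof.
move=> [uL tL pL] cL; split.
- rewrite cat_uniq rem_uniq// kids_uniq andbT.
  apply/hasPn => v /mem_kids[x [-> _ _]]; apply/negP => /mem_rem /pL.
  by rewrite ltnn.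
- move=> v; rewrite mem_cat => /orP[|/mem_kids[x [-> _ _]]]; last exact: rank_cons.
  rewrite mem_rem_uniq// inE => /andP[vc /tL]; rewrite leq_eqVlt => /predU1P[/rank_inj e|//].
  by rewrite e eqxx in vc.
move=> x a; rewrite mem_cat => /orP[/mem_rem/pL/ltnW//|/mem_kids[y [[_ ->] _ _]]].
exact: ltnSn.
Qed.

Lemma frontier_skip t L : frontier t L -> (forall v, v \in L -> rank v <> t) ->
  frontier t.+1 L.
Proof.
move=> [uL tL pL] nt; split => // [v vL|x c /pL/ltnW//].
by have := tL _ vL; rewrite leq_eqVlt => /predU1P[/esym/nt|].
Qed.

Section Sweep.
Context (d : measure_display) (T : measurableType d) (R : realType).
Variables (P : probability T R) (phi0 : nat) (p : nat -> progeny -> R).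
Variable xi : label -> T -> progeny.
Hypothesis LHBP : lower_hessenberg_branching phi0 p P xi.

Let law := lhb_law LHBP.

Section Keep.
Variables (keep : pred nat) (fin : seq label -> seq label -> bool).

Local Notation sw := (sweep keep phi0 fin).

Lemma fresh_sweep J n t V L : (forall v, v \in J -> (rank v < t)%N) ->
  fresh J (sw n t V L).
Proof.
elim: n J t V L => //= n IH J t V L Jt.
have JtS v : v \in J -> (rank v < t.+1)%N by move=> /Jt /ltnW.
case e : label_of_rank => [c|]; last exact: IH.
have ct := label_of_rank_some e.
case: ifP => _; last exact: IH.
split; first by apply/negP => /Jt; rewrite ct ltnn.
by move=> r; apply: IH => v; rewrite inE => /predU1P[->|/JtS//]; rewrite ct.
Qed.

Lemma sweep_determined n t V L w w' :
  (forall u, (t <= rank u < t + n)%N -> xi u w = xi u w') ->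
  run xi (sw n t V L) w = run xi (sw n t V L) w'.
Proof.
elim: n t V L => //= n IH t V L ww'.
have ww1 u : (t.+1 <= rank u < t.+1 + n)%N -> xi u w = xi u w'.
  by move=> tu; apply: ww'; lia.
case e : label_of_rank => [c|]; last exact: IH.
case: ifP => _ /=; last exact: IH.
by rewrite ww'; [exact: IH|rewrite (label_of_rank_some e); lia].
Qed.

(** Supermartingale bound: the mean of [Phi] does not grow when a label is explored, and [Phi] is at
    least 1 where the run answers true. *)
Lemma sweep_value_le (Phi : seq label -> seq label -> R) (C : R) n t V L :
  (forall V L, (0 <= Phi V L <= C)%R) ->
  (forall V L, fin V L -> (1 <= Phi V L)%R) ->
  (forall V L c, c \in L ->
    (expect p (type_of phi0 c)
       (fun r => Phi (c :: V) (rem c L ++ kids keep phi0 c r)) <= Phi V L)%R) ->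
  (value p phi0 (sw n t V L) <= Phi V L)%R.
Proof.
move=> PhiC Phi1 PhiE; elim: n t V L => [|n IH] t V L /=.
  by case e : (fin V L); [exact: Phi1|case/andP: (PhiC V L)].
case: label_of_rank => [c|//]; case: ifP => //= cL.
apply: le_trans (PhiE V L c cL); apply: (le_expect law) => //.
- by apply: bounded_unit => r _; exact: value_unit.
- by exists C => r _.
Qed.

(* [A] is the part of the tree that is reached from [L]. *)
Lemma sweep_exhausts (A : label -> Prop) w (N n t : nat) V L :
  (forall V, fin V [::]) ->
  (forall c x, A c -> keep x.1 -> (x.2 < xi c w x.1)%N -> A (x :: c)) ->
  (forall v, A v -> (rank v < N)%N) ->
  frontier t L -> (forall v, v \in L -> A v) -> (N <= t + n)%N ->
  run xi (sw n t V L) w.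
Proof.
move=> fin0 Aclosed AN; elim: n t V L => [|n IH] t V L /=.
  move=> [_ tL _] LA; rewrite addn0 => Nt; case: L tL LA => [|v L] tL LA //.
  have := AN v (LA v (mem_head _ _)); have := tL v (mem_head _ _); lia.
move=> fL LA Ntn; have Ntn1 : (N <= t.+1 + n)%N by lia.
case e : label_of_rank => [c|]; last first.
  apply: IH => //; apply: frontier_skip => // v _ vt.
  by move: e; rewrite -vt label_of_rankK.
have ct := label_of_rank_some e; case: ifP => cL /=.
  apply: IH => //; first by rewrite -ct; apply: frontier_ask => //; rewrite ct.
  move=> v; rewrite mem_cat => /orP[/mem_rem/LA//|/mem_kids[x [-> kx rx]]].
  by apply: Aclosed => //; exact: LA.
apply: IH => //; apply: frontier_skip => // v vL vt.
by move: e; rewrite -vt label_of_rankK => -[vc]; rewrite -vc vL in cL.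
Qed.

End Keep.

Lemma prod_kids (keep : pred nat) (h : nat -> R) c r :
  (forall l, ~~ keep l -> h l = 1%R) ->
  (\prod_(v <- kids keep phi0 c r) h (type_of phi0 v) =
   progeny_prod h (type_of phi0 c) r)%R.
Proof.
move=> hk; rewrite /kids big_flatten big_map big_filter /progeny_prod.
rewrite -(big_mkord xpredT (fun l => h l ^+ r l)%R) /index_iota subn0 big_mkcond/=.
apply: eq_bigr => l _; case: ifPn => [_|/hk ->]; last by rewrite expr1n.
by rewrite big_map /= big_const_seq count_predT size_iota iter_mulr_1.
Qed.

(** Exploring [c] replaces its factor [h] by [gen_fun p h]; types that are not kept carry the factor
    1. *)
Lemma expect_prod_frontier (keep : pred nat) (h : nat -> R) c L :
  unit_valued h -> (forall l, ~~ keep l -> h l = 1%R) -> c \in L ->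
  expect p (type_of phi0 c) (fun r =>
    \prod_(v <- rem c L ++ kids keep phi0 c r) h (type_of phi0 v))%R =
  ((\prod_(v <- rem c L) h (type_of phi0 v)) * gen_fun p h (type_of phi0 c))%R.
Proof.
move=> h1 hk cL; rewrite /gen_fun -expectZ//.
- by apply: eq_expect => r _; rewrite big_cat/= prod_kids.
- by apply: prodr_ge0 => v _; case/andP: (h1 (type_of phi0 v)).
exact: progeny_prod_bounded.
Qed.

Lemma prod_unit (h : nat -> R) (L : seq label) : unit_valued h ->
  (0 <= \prod_(v <- L) h (type_of phi0 v) <= 1)%R.
Proof.
move=> h1; rewrite prodr_ge0 => [|v _] /=; last by case/andP: (h1 (type_of phi0 v)).
exact: Num.Theory.prodr_ile1.
Qed.

(** * A truncation that survives with positive probability *)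

Section TruncatedSurvival.
Variables (k : nat) (h : nat -> R).
Hypotheses (h1 : unit_valued h) (hk : forall j, (k < j)%N -> h j = 1%R).
Hypotheses (hF : forall j, (gen_fun p h j <= h j)%R) (hphi : (h phi0 < 1)%R).

(** For [N] at most the rank of [u] no step is made, and the nonempty list answers false. *)
Let exhausted (N : nat) (u : label) :=
  sweep (fun l => l <= k)%N phi0 (fun _ L => nilp L) (N - rank u) (rank u) [::] [:: u].

(** The product of [h] over the frontier is a supermartingale that starts at [h phi0] and is 1 on an
    empty frontier, so a truncated subtree is finite with probability at most [h phi0 < 1]. *)
Lemma truncated_survival : {ae P, forall w,
  unbounded (fun u => in_tree xi w u /\ type_of phi0 u = phi0) ->
  exists K, unbounded (fun u =>
    [/\ in_tree xi w u, types_below phi0 K u & (type_of phi0 u <= K)%N])}.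
Proof.
have q01 : (0 <= h phi0 < 1)%R by rewrite hphi andbT; case/andP: (h1 phi0).
pose D N u := [set w | run xi (exhausted N u) w].
apply: (@negligibleS _ _ _ _ _ _ _
  (@trials_negligible _ _ _ _ _ _ _ LHBP (fun u => type_of phi0 u = phi0) D _ q01 _ _ _)).
- move=> w /not_implyP[ub noK]; split => // u [tu up0]; apply: contrapT => noN.
  (* [K] bounds the types on the line to [u], so the subtree of [u] truncated at [k] lies in the
     tree truncated at [maxn k K]. *)
  apply: noK; have [K uK] : exists K, forall v, suffix v u -> (type_of phi0 v <= K)%N.
    elim: (u) => [|x v [K vK]].
      by exists phi0 => v; rewrite suffixs0 => /eqP ->.
    exists (maxn x.1 K) => a /suffix_cons_inv[->|/vK aK]; first exact: leq_maxl.
    exact: leq_trans aK (leq_maxr _ _).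
  exists (maxn k K); pose A v := in_tree xi w v /\
    forall a, suffix a v -> (type_of phi0 a <= maxn k K)%N.
  suff : unbounded A.
    apply: sub_unbounded => v [tv vK]; split => //; last exact: vK (suffix_refl _).
    by move=> a /vK.
  move=> N; apply: contrapT => /forallNP nA; apply: noN; exists (maxn N (rank u)).
  apply: (@sweep_exhausts _ _ A w N) => //.
  + move=> c x [tc cK] xk xr; split => // a /suffix_cons_inv[->|/cK//].
    exact: leq_trans xk (leq_maxl _ _).
  + by move=> v Av; rewrite ltnNge; apply/negP => Nv; exact: (nA v).
  + exact: frontier_root.
  + move=> v; rewrite inE => /eqP ->; split => // a /uK aK.
    exact: leq_trans aK (leq_maxr _ _).
  by have := leq_maxl N (rank u); lia.
(* Once the frontier is empty, further steps leave it empty. *)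
- move=> N u w; rewrite /D /= /exhausted.
  have [uN|Nu] := leqP (rank u) N; last first.
    by have -> : (N.+1 - rank u = N - rank u)%N by lia.
  rewrite subSn//; move: (N - rank u)%N => n.
  elim: n (rank u) ([::] : seq label) [:: u] => [|n IH] t V L.
    case: L => [|a L] //=; case: label_of_rank => [c|] //=.
  rewrite -[n.+2]/((n.+1).+1); set m := n.+1 in IH *.
  rewrite [sweep _ _ _ m _ _ _]/= [sweep _ _ _ m.+1 _ _ _]/=.
  case: label_of_rank => [c|]; last exact: IH.
  by case: ifP => _ /=; exact: IH.
- move=> N u w w' ww'; rewrite /D /= /exhausted (@sweep_determined _ _ _ _ _ _ w w')// => v.
  by move=> /andP[uv vN]; apply: ww'; lia.
move=> N u X uphi dX.
have fr : fresh (labels_below (rank u)) (exhausted N u).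
  by apply: fresh_sweep => v; rewrite mem_labels_below.
have [_ /le_trans] := determined_run_le LHBP fr dX; apply.
rewrite lee_wpmul2r// lee_fin.
have := @sweep_value_le (fun l => l <= k)%N (fun _ L => nilp L)
  (fun _ L => \prod_(v <- L) h (type_of phi0 v))%R 1%R (N - rank u) (rank u) [::] [:: u].
rewrite big_seq1 uphi; apply.
- by move=> _ L; exact: prod_unit.
- by move=> _ [|//] _; rewrite big_nil.
move=> _ L c cL; rewrite expect_prod_frontier//; last first.
  by move=> l; rewrite -ltnNge; exact: hk.
rewrite [leRHS](perm_big _ (perm_to_rem cL)) big_cons mulrC ler_wpM2r//.
by case/andP: (prod_unit (rem c L) h1).
Qed.

End TruncatedSurvival.

(** * Finiteness of the number of individuals of the initial type *)

Section NonSupercritical.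
Hypothesis sub : forall e : R, (0 < e)%R -> exists (s : R) (h : nat -> R),
  [/\ unit_valued h, (1 - e < h phi0)%R, (0 <= s < 1)%R &
     forall j, (h j <= (if j == phi0 then s else 1) * gen_fun p h j)%R].

Let is_phi0 (v : label) := type_of phi0 v == phi0.

Local Notation counting_sweep m :=
  (sweep predT phi0 (fun V _ => (m <= count is_phi0 V)%N)).

Let counting_sweep_enough m n t V L w : (m <= count is_phi0 V)%N ->
  run xi (counting_sweep m n t V L) w.
Proof.
elim: n t V L => //= n IH t V L mV.
case: label_of_rank => [c|]; last exact: IH.
case: ifP => _ /=; last exact: IH.
by apply: IH; rewrite /= (leq_trans mV)// leq_addl.
Qed.

Let counting_sweep_incr m n t V L w :
  run xi (counting_sweep m n t V L) w -> run xi (counting_sweep m n.+1 t V L) w.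
Proof.
elim: n t V L => [|n IH] t V L.
  by move=> /counting_sweep_enough; exact.
set N := n.+1 in IH *.
rewrite [sweep _ _ _ N _ _ _]/= [sweep _ _ _ N.+1 _ _ _]/=.
case: label_of_rank => [c|]; last exact: IH.
by case: ifP => _ /=; exact: IH.
Qed.

(** [Q] lists individuals of type [phi0] still to be met; each stays below some label of the
    frontier until it is explored itself. *)
Let counting_sweep_reaches m n t V L (Q : seq label) w :
  frontier t L -> uniq Q ->
  (forall q, q \in Q -> [/\ in_tree xi w q, is_phi0 q, (rank q < t + n)%N &
     exists2 a, a \in L & suffix a q]) ->
  (m <= count is_phi0 V + size Q)%N ->
  run xi (counting_sweep m n t V L) w.
Proof.
elim: n t V L Q => [|n IH] t V L Q fL uQ QP mV /=.
  case: Q uQ QP mV => [|q Q] _ QP; rewrite ?addn0//.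
  have [_ _ + [a aL aq]] := QP q (mem_head _ _); have [_ tL _] := fL.
  have := tL a aL; have [->|/(rank_suffix aq)] := eqVneq a q; lia.
have skip : (forall v, v \in L -> rank v <> t) ->
    run xi (sweep predT phi0 (fun V _ => m <= count is_phi0 V)%N n t.+1 V L) w.
  move=> nt; apply: (IH _ _ _ Q) => //; first exact: frontier_skip.
  by move=> q /QP[? ? ? ?]; split => //; lia.
case e : label_of_rank => [c|]; last first.
  by apply: skip => v _ vt; move: e; rewrite -vt label_of_rankK.
have ct := label_of_rank_some e; case: ifP => cL /=; last first.
  by apply: skip => v vL vt; move: e; rewrite -vt label_of_rankK => -[vc]; rewrite -vc vL in cL.
apply: (IH _ _ _ (rem c Q)).
- by rewrite -ct; apply: frontier_ask => //; rewrite ct.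
- exact: rem_uniq.
- move=> q; rewrite mem_rem_uniq// inE => /andP[qc /QP[tq pq qt [a aL aq]]].
  split => //; first by lia.
  have [ac|ac] := eqVneq a c; last first.
    by exists a => //; rewrite mem_cat mem_rem_uniq ?inE ?ac ?aL//; case: fL.
  have /suffixP[s qE] := aq; rewrite ac in qE.
  (* The line from [c] to [q] continues with the child [x :: c], which replaces [c] in the
     frontier. *)
  have [x [s' sE]] : exists x s', s = rcons s' x.
    by case/lastP: s qE => [qE|s' x]; [rewrite qE eqxx in qc|exists x, s'].
  exists (x :: c); last by apply/suffixP; exists s'; rewrite qE sE cat_rcons.
  rewrite mem_cat; apply/orP; right; apply: kids_mem => //; first exact: progeny_range LHBP _ _.
  have : in_tree xi w (s' ++ x :: c) by rewrite -cat_rcons -sE -qE.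
  by elim: s' {sE} => [[]|y s' IHs [/IHs]].
apply: leq_trans mV _; have [cQ|cQ] := boolP (c \in Q).
  have [_ pc _ _] := QP c cQ.
  by rewrite (perm_size (perm_to_rem cQ)) /= pc add1n addSnnS.
by rewrite rem_id//= leq_add2r leq_addl.
Qed.

(** Markov's inequality, applied to 1 minus the product of [s ^ count] and of [h] over the frontier;
    that product is a submartingale with values in [0, 1] that starts at [h phi0], close to 1. *)
Let count_bound e : (0 < e)%R -> exists m, forall n,
  P [set w | run xi (counting_sweep m n 0 [::] [:: [::]]) w] <= e%:E.
Proof.
move=> e0; have e20 : (0 < e / 2)%R by rewrite divr_gt0.
have [s [h [h1 he /andP[s0 s1] hs]]] := sub e20.
(* With s ^ m <= 1 / 2 the final bound (e / 2) / (1 - s ^ m) is at most [e]. *)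
have [m sm] : exists m, (s ^+ m <= 1 / 2)%R.
  have : (s ^+ n @[n --> \oo] --> (0 : R))%R by apply: cvg_expr; rewrite ger0_norm.
  move=> /cvgrPdist_le/(_ (1 / 2))%R[|m _ /(_ m (leqnn m))]; first by rewrite divr_gt0.
  by rewrite sub0r normrN ger0_norm ?exprn_ge0//; exists m.
exists m => n; have sm1 : (0 < 1 - s ^+ m)%R by lra.
(* The normalisation makes [Phi] at least 1 once [m] individuals of type [phi0] have been
   explored. *)
pose Phi (V L : seq label) : R :=
  ((1 - s ^+ count is_phi0 V * \prod_(v <- L) h (type_of phi0 v)) / (1 - s ^+ m))%R.
have sp V L : (0 <= s ^+ count is_phi0 V * \prod_(v <- L) h (type_of phi0 v) <= 1)%R.
  have /andP[a0 a1] := prod_unit L h1.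
  have b0 : (0 <= s ^+ count is_phi0 V)%R by rewrite exprn_ge0.
  have b1 : (s ^+ count is_phi0 V <= 1)%R by rewrite exprn_ile1// ltW.
  by rewrite mulr_ge0//= mulr_ile1.
have fr : fresh (labels_below 0) (counting_sweep m n 0 [::] [:: [::]]).
  by apply: fresh_sweep => v; rewrite mem_labels_below.
have dT : determined_below xi 0 [set: T] by [].
have [_] := determined_run_le LHBP fr dT; rewrite setTI => /le_trans; apply.
rewrite probability_setT mule1 lee_fin.
apply: (@le_trans _ _ (Phi [::] [:: [::]])).
  apply: (@sweep_value_le _ _ Phi (1 / (1 - s ^+ m))%R).
  - move=> V L; have /andP[? ?] := sp V L; rewrite divr_ge0 ?(ltW sm1) ?subr_ge0//=.
    by rewrite ler_pM2r ?invr_gt0// gerBl.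
  - move=> V L mV; rewrite ler_pdivlMr// mul1r lerD2l lerN2.
    have /andP[a0 a1] := prod_unit L h1.
    apply: (@le_trans _ _ (s ^+ count is_phi0 V)%R); first by rewrite ler_piMr// exprn_ge0.
    by apply: ler_wiXn2l => //; exact: ltW.
  move=> V L c cL; pose a : R := (s ^+ count is_phi0 (c :: V))%R.
  have a0 : (0 <= a)%R by rewrite exprn_ge0.
  pose X r : R := (\prod_(v <- rem c L ++ kids predT phi0 c r) h (type_of phi0 v))%R.
  have X1 r : hessenberg (type_of phi0 c) r -> (0 <= X r <= 1)%R.
    by move=> _; exact: prod_unit.
  have EX : (expect p (type_of phi0 c) (fun r => Phi (c :: V) (rem c L ++ kids predT phi0 c r))
      = (1 - a * expect p (type_of phi0 c) X) / (1 - s ^+ m))%R.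
    apply/eqP; rewrite eq_sym -subr_eq0; apply/eqP.
    have aX r : (0 <= a * X r <= 1)%R.
      have := sp (c :: V) (rem c L ++ kids predT phi0 c r).
      by rewrite -/a -/(X r).
    have b1 : bounded_progeny_fun (type_of phi0 c) (fun r => 1 - a * X r)%R.
      by apply: bounded_unit => r _; have := aX r; lra.
    have bX : bounded_progeny_fun (type_of phi0 c) X by exact: bounded_unit.
    have -> : expect p (type_of phi0 c)
        (fun r => Phi (c :: V) (rem c L ++ kids predT phi0 c r)) =
        ((1 - s ^+ m)^-1 * expect p (type_of phi0 c) (fun r => 1 - a * X r))%R.
      rewrite -(expectZ law)//; last by rewrite invr_ge0 ltW.
      by apply: eq_expect => r _; rewrite mulrC.
    have : (expect p (type_of phi0 c) (fun r => 1 - a * X r) +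
            a * expect p (type_of phi0 c) X = 1)%R.
      rewrite -(expectZ law)// -(expectD law)//; last exact: boundedZ.
      by rewrite -[RHS](expect_cst law (type_of phi0 c))//; apply: eq_expect => r _; ring.
    move=> eE; have -> : expect p (type_of phi0 c) (fun r => 1 - a * X r)%R =
      (1 - a * expect p (type_of phi0 c) X)%R by lra.
    by rewrite mulrC subrr.
  rewrite EX expect_prod_frontier// ler_pM2r ?invr_gt0// lerD2l lerN2.
  rewrite [in leLHS](perm_big _ (perm_to_rem cL)) big_cons.
  set B := (\prod_(v <- rem c L) _)%R; set G := gen_fun _ _ _.
  have /andP[B0 _] : (0 <= B <= 1)%R := prod_unit (rem c L) h1.
  rewrite /a /= exprD; set b := (s ^+ count is_phi0 V)%R.
  have b0 : (0 <= b)%R by rewrite exprn_ge0.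
  have hG : (h (type_of phi0 c) <= s ^+ is_phi0 c * G)%R.
    by have := hs (type_of phi0 c); rewrite -/(is_phi0 c); case: is_phi0; rewrite ?expr1 ?expr0.
  rewrite (_ : s ^+ is_phi0 c * b * (B * G) = b * (s ^+ is_phi0 c * G * B))%R; last by ring.
  by rewrite ler_wpM2l// ler_wpM2r.
rewrite /Phi /= expr0 mul1r big_seq1 /= ler_pdivrMr//.
have : (e / 2 <= e * (1 - s ^+ m))%R by rewrite ler_pM2l//; lra.
by move: he; lra.
Qed.

(** If [phi0] recurs, the exploration meets [m] such individuals in finite time, an event of
    probability at most [e]. *)
Lemma finitely_many_phi0 : {ae P, forall w,
  ~ unbounded (fun u => in_tree xi w u /\ type_of phi0 u = phi0)}.
Proof.
apply: negligible_of_small_covers => e e0; have [m mP] := count_bound e0.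
pose S n := [set w | run xi (counting_sweep m n 0 [::] [:: [::]]) w].
have mS n : measurable (S n).
  apply: (determined_measurable LHBP (n := n)) => w w' ww'.
  by rewrite /S /= (@sweep_determined _ _ _ _ _ _ w w').
have mU : measurable (\bigcup_n S n) by exact: bigcupT_measurable.
exists (\bigcup_n S n); split => //; last first.
  apply: (cvge_to_le (nondecreasing_cvg_mu mS mU _)); last exact: nearW.
  apply/nondecreasing_seqP => n; apply/subsetPset => w; exact: counting_sweep_incr.
move=> w /= /contrapT ub.
have [Q [uQ sQ QP]] : exists Q : seq label, [/\ uniq Q, size Q = m &
    forall q, q \in Q -> in_tree xi w q /\ type_of phi0 q = phi0].
  elim: (m) => [|k [Q [uQ sQ QP]]]; first by exists [::].
  have [u [Qu up]] := ub (\max_(q <- Q) (rank q).+1).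
  exists (u :: Q); split; rewrite /= ?sQ ?uQ ?andbT//.
    apply/negP => uQ'; suff : (rank u < \max_(q <- Q) (rank q).+1)%N by rewrite ltnNge Qu.
    exact: (@leq_bigmax_seq _ Q xpredT (fun q => (rank q).+1) u uQ' isT).
  by move=> q; rewrite inE => /predU1P[->|/QP].
exists (\max_(q <- Q) (rank q).+1) => //.
apply: (counting_sweep_reaches (Q := Q)) => //; last by rewrite sQ.
move=> q qQ; have [tq pq] := QP q qQ; split => //; first exact/eqP.
  by rewrite add0n; exact: (@leq_bigmax_seq _ Q xpredT (fun q => (rank q).+1) q qQ isT).
by exists [::]; rewrite ?inE// suffix0s.
Qed.

End NonSupercritical.

End Sweep.

(** * Extinction *)

Lemma finite_set_bounded (A : set label) : finite_set A <-> ~ unbounded A.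
Proof.
split=> [/finite_seqP[s ->] us|/existsNP[n /forallNP nA]].
  have [u [su us']] := us (\max_(v <- s) (rank v).+1).
  suff : (rank u < \max_(v <- s) (rank v).+1)%N by rewrite ltnNge su.
  exact: (@leq_bigmax_seq _ s xpredT (fun v => (rank v).+1) u us' isT).
apply: (@sub_finite_set _ _ [set` labels_below n]); last exact: finite_seq.
by move=> u Au /=; rewrite mem_labels_below ltnNge; apply/negP => nu; apply: (nA u).
Qed.

(** * Cardinalities of sets of labels *)

Section Counting.
Variable R : realType.

(** The injective numbering moves counts to the natural numbers, so that countable additivity of the
    counting measure there can be used. *)
Lemma counting_rank (A : set label) :
  counting A = counting (rank @` A) :> \bar R.
Proof.
rewrite /counting; have [finA|infA] := pselect (finite_set A).
  rewrite !asboolT//; last exact: finite_image.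
  rewrite fset_set_image// card_imfset//=; exact: rank_inj.
rewrite !asboolF// => fin; apply: infA; apply/finite_set_bounded => uA.
have /finite_seqP[s sE] := fin.
have [u [su Au]] := uA (\max_(m <- s) m.+1).
have us : rank u \in s by have : [set` s] (rank u) by rewrite -sE; exists u.
suff : (rank u < \max_(m <- s) m.+1)%N by rewrite ltnNge su.
exact: (@leq_bigmax_seq _ s xpredT (fun m => m.+1) _ us isT).
Qed.

Lemma counting_ge1 (A : set label) : A !=set0 -> 1 <= counting A :> \bar R.
Proof.
move=> [u Au]; rewrite /counting; case: asboolP => [finA|_]; last by rewrite leey.
rewrite lee_fin ler1n cardfs_gt0; apply/fset0Pn; exists u.
by rewrite in_fset_set// inE.
Qed.

Lemma counting_lt1 (A : set label) : counting A < 1 :> \bar R -> A = set0.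
Proof.
move=> A1; apply: contrapT => /eqP/set0P/counting_ge1.
by rewrite leNgt A1.
Qed.

Lemma counting_lty (A : set label) : counting A < +oo :> \bar R <-> finite_set A.
Proof.
by rewrite /counting; case: asboolP => finA; split; rewrite ?ltry ?ltxx.
Qed.

Lemma counting_set0 : counting (set0 : set label) = 0 :> \bar R.
Proof. by rewrite counting_rank image_set0 measure0. Qed.

Lemma counting_bigcup (F : nat -> set label) :
  (forall m n u, F m u -> F n u -> m = n) ->
  \sum_(0 <= n <oo) counting (F n) = counting (\bigcup_n F n) :> \bar R.
Proof.
move=> Finj; rewrite counting_rank image_bigcup measure_semi_bigcup//.
  by apply: eq_eseriesr => n _; rewrite counting_rank.
by move=> m n _ _ [_ [[u Fu <-] [v Fv /rank_inj vu]]]; apply: Finj Fu _; rewrite -vu.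
Qed.

(** Counts are integers or infinite, so a count below 1 means an empty set. *)
Lemma counting_cvg0 (F : nat -> set label) :
  (counting (F n) : \bar R) @[n --> \oo] --> 0 <->
  exists N, forall n, (N <= n)%N -> F n = set0.
Proof.
split=> [F0|[N FN]].
  have := F0 _ (@open_ereal_lt' R 0 1 lte01) => -[N _ NF].
  by exists N => n /NF /counting_lt1.
by apply: cvg_near_cst; exists N => // n /FN ->; exact: counting_set0.
Qed.

End Counting.

(** * The two equivalences at a fixed point of the probability space *)

Section Extinction.
Context (T : Type) (R : realType) (phi0 : nat) (xi : label -> T -> progeny) (w : T).
Hypothesis range : forall u, hessenberg (type_of phi0 u) (xi u w).

Let tree (u : label) := in_tree xi w u.

Lemma child_type x u : tree (x :: u) -> (x.1 <= (type_of phi0 u).+1)%N.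
Proof.
by move=> [_ xr]; rewrite leqNgt; apply: contraL xr => /range ->.
Qed.

Lemma finite_generations n :
  exists Q : seq label, forall u, tree u -> (size u <= n)%N -> u \in Q.
Proof.
elim: n => [|n [Q QP]]; first by exists [:: [::]] => -[].
exists ([::] :: flatten (map (fun c => kids predT phi0 c (xi c w)) Q)) => -[//|x u].
move=> [tu xr] su; rewrite inE; apply/flatten_mapP; exists u; first exact: QP.
exact: kids_mem.
Qed.

Lemma unbounded_sizes (A : label -> Prop) n : (forall u, A u -> tree u) ->
  unbounded A -> exists u, (n <= size u)%N /\ A u.
Proof.
move=> At uA; apply: contrapT => /forallNP nA; have [Q QP] := finite_generations n.
apply: (finite_set_bounded A).1 uA; apply: (@sub_finite_set _ _ [set` Q]).
  move=> u Au; apply: QP; first exact: At.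
  by rewrite leqNgt; apply/negP => /ltnW nu; apply: (nA u).
exact: finite_seq.
Qed.

Lemma size_rank u : (size u <= rank u)%N.
Proof. by elim: u => //= x u IH; exact: leq_ltn_trans IH (rank_cons _ _). Qed.

(** Generations are finite, so infinitely many individuals reach arbitrarily late generations;
    conversely, the generation of a label is at most its rank. *)
Lemma extinct_bounded (A : label -> Prop) : (forall u, A u -> tree u) ->
  (exists N, forall n, (N <= n)%N -> [set u | A u /\ size u = n] = set0) <->
  ~ unbounded A.
Proof.
move=> At; split=> [[N NA] uA|/existsNP[N /forallNP NA]].
  have [u [Nu Au]] := unbounded_sizes N At uA.
  by have /eqP := NA _ Nu; apply/negP/set0P; exists u.
exists N => n Nn; apply/seteqP; split => // u [Au un]; apply: (NA u); split => //.
by apply: leq_trans (size_rank u); rewrite un.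
Qed.

Lemma partial_extinctionP : partial_extinction xi phi0 R w <->
  forall l, ~ unbounded (fun u => tree u /\ type_of phi0 u = l).
Proof.
have ZE n l : Z xi phi0 R n l w =
    counting [set u | (tree u /\ type_of phi0 u = l) /\ size u = n].
  by congr counting; apply/seteqP; split=> u /= [] => [? ? ?|[? ?] ?]; split.
rewrite /partial_extinction/=; under eq_forall => l do under eq_fun do rewrite ZE.
by split=> + l => /(_ l); rewrite counting_cvg0 extinct_bounded// => u [].
Qed.

Lemma global_extinctionP : global_extinction xi phi0 R w <-> ~ unbounded tree.
Proof.
have ZE n : \sum_(0 <= l <oo) Z xi phi0 R n l w = counting [set u | tree u /\ size u = n].
  rewrite counting_bigcup => [|k l u [_ _ <-] [_ _ <-]//]; congr counting.
  apply/seteqP; split=> u /=; first by move=> [l _ [? ? _]].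
  by move=> [? ?]; exists (type_of phi0 u).
rewrite /global_extinction/=; under eq_fun do rewrite ZE.
by rewrite counting_cvg0 extinct_bounded.
Qed.

Definition record (k : nat) (u : label) : Prop :=
  in_sterile_tree xi phi0 (k%:Z - 1)%R w u /\ type_of phi0 u = k.

Lemma YE k : Y xi phi0 R k w = counting [set u | record k u].
Proof.
rewrite /Y counting_bigcup => [|m n u [_ <- _] [_ <- _]//]; congr counting.
apply/seteqP; split=> u /=; first by move=> [n _ [? _ ?]].
by move=> [? ?]; exists (size u).
Qed.

Lemma recordS k u :
  record k.+1 u <-> [/\ tree u, types_below phi0 k u & type_of phi0 u = k.+1].
Proof.
have kE : (k.+1%:Z - 1 = k%:Z)%R by rewrite intS addrC addKr.
rewrite /record /in_sterile_tree kE.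
by split=> [[[tu su] uk]|[tu su uk]]; repeat split => //; move=> v vu vnu;
   have := su v vu vnu; rewrite lez_nat.
Qed.

Hypothesis records_unbounded : forall k,
  unbounded (fun u => [/\ tree u, types_below phi0 k u & (type_of phi0 u <= k)%N]) ->
  unbounded (fun u => [/\ tree u, types_below phi0 k u & type_of phi0 u = k.+1]).

(** A finite tree has bounded types. Conversely, without records of type K + 1, types that rise by
    at most 1 per generation never exceed [K], and an infinite tree would have such records by
    [records_unbounded]. *)
Lemma global_extinction_embedded : global_extinction xi phi0 R w <->
  Y xi phi0 R k w @[k --> \oo] --> 0.
Proof.
rewrite global_extinctionP; under eq_fun do rewrite YE; rewrite counting_cvg0; split.
  move=> /finite_set_bounded/finite_seqP[s sE].
  exists (\max_(v <- s) (type_of phi0 v).+1)%N => k ks.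
  apply/seteqP; split => // u [[tu _] uk].
  have us : u \in s by have : [set` s] u by rewrite -sE.
  suff : (type_of phi0 u < \max_(v <- s) (type_of phi0 v).+1)%N by rewrite uk ltnNge ks.
  exact: (@leq_bigmax_seq _ s xpredT (fun v => (type_of phi0 v).+1) u us isT).
move=> [N noR]; pose K := maxn N phi0.
have noRK u : ~ [/\ tree u, types_below phi0 K u & type_of phi0 u = K.+1].
  move=> /recordS Ru; have /eqP := noR K.+1 (leqW (leq_maxl _ _)).
  by apply/negP/set0P; exists u.
have lowT u : tree u -> types_below phi0 K u /\ (type_of phi0 u <= K)%N.
  elim: u => [_|x u IH tx].
    split; last exact: leq_maxr.
    by move=> v; rewrite suffixs0 => /eqP ->; rewrite eqxx.
  have [/IH[bu uK] _] := tx.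
  have bx : types_below phi0 K (x :: u).
    move=> v /suffix_cons_inv[->|vu]; first by rewrite eqxx.
    by have [->//|vnu] := eqVneq v u => _; exact: bu.
  split => //; have := child_type tx; rewrite leqNgt => xu.
  rewrite leqNgt; apply/negP => Kx; apply: (noRK (x :: u)); split => //=.
  by move: xu Kx => /=; lia.
move=> uT; have uS : unbounded (fun u =>
    [/\ tree u, types_below phi0 K u & (type_of phi0 u <= K)%N]).
  by apply: sub_unbounded uT => u tu; have [? ?] := lowT u tu.
by have [u [_ /noRK]] := records_unbounded uS 0%N.
Qed.

Hypothesis phi0_recurs : forall l,
  unbounded (fun u => tree u /\ type_of phi0 u = l) ->
  unbounded (fun u => tree u /\ type_of phi0 u = phi0).
Hypothesis truncation_survives : unbounded (fun u => tree u /\ type_of phi0 u = phi0) ->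
  exists K, unbounded (fun u =>
    [/\ tree u, types_below phi0 K u & (type_of phi0 u <= K)%N]).

(** If some type recurs, so does [phi0], hence some truncation is infinite and yields infinitely
    many records; conversely, records of type [k] are individuals of type [k]. *)
Lemma partial_extinction_embedded : partial_extinction xi phi0 R w <->
  forall k, (phi0 <= k)%N -> Y xi phi0 R k w < +oo.
Proof.
rewrite partial_extinctionP; split=> [ext k _|Yfin l].
  rewrite YE; apply/counting_lty/finite_set_bounded => uk.
  by apply: (ext k); apply: sub_unbounded uk => u [[tu _] uk].
move=> /phi0_recurs/truncation_survives[K uK].
(* The root is an ancestor of a label of the truncation, or that label itself. *)
have K0 : (phi0 <= K)%N.
  have [[|x u] [_ [_ bu uK']]] := uK 0%N; first exact: uK'.
  by apply: (bu [::]) => //; exact: suffix0s.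
have := Yfin K.+1 (leqW K0); rewrite YE => /counting_lty/finite_set_bounded; apply.
by apply: sub_unbounded (records_unbounded uK) => u /recordS.
Qed.

End Extinction.

Theorem corollary1 (R : realType) (d : measure_display) (T : measurableType d)
    (P : probability T R) (phi0 : nat) (p : nat -> progeny -> R)
    (xi : label -> T -> progeny)
    (LHBP : lower_hessenberg_branching phi0 p P xi)
    (irr : irreducible p) (nsing : nonsingular p)
    (up : forall i : nat, 0 < mean_progeny p i i.+1) :
  {ae P, forall w : T,
     global_extinction xi phi0 R w <->
     Y xi phi0 R k w @[k --> \oo] --> 0} /\
  {ae P, forall w : T,
     partial_extinction xi phi0 R w <->
     (forall k : nat, (phi0 <= k)%N -> Y xi phi0 R k w < +oo)}.
Proof.
have law := lhb_law LHBP.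
have range w u : hessenberg (type_of phi0 u) (xi u w) by exact: progeny_range LHBP _ _.
have records := sterile_tree_records LHBP up.
have recurs := type_recurrence LHBP irr.
have survives : {ae P, forall w,
    unbounded (fun u => in_tree xi w u /\ type_of phi0 u = phi0) ->
    exists K, unbounded (fun u =>
      [/\ in_tree xi w u, types_below phi0 K u & (type_of phi0 u <= K)%N])}.
  (* In the second case of the dichotomy the premise fails almost surely. *)
  have [[k [h [h1 hk hF hphi]]]|sub] := generating_function_dichotomy law irr nsing phi0.
    exact: truncated_survival LHBP _ _ h1 hk hF hphi.
  by apply: filterS (finitely_many_phi0 LHBP sub) => w nu /nu.
split.
  by apply: filterS records => w rw; exact: global_extinction_embedded.
apply: filterS3 records recurs survives => w rw cw sw.
exact: partial_extinction_embedded.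
Qed.
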